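(* Let $(x_0,v_0)\in\mathbb R^3_0\times\mathbb R^3$ lie on a non-degenerate elliptic Keplerian orbit, i.e. $L_0:=L(x_0,v_0)\neq0$ and $A_0:=A(x_0,v_0)$ satisfies $|A_0|<\mu$. For any $c$ with $0<c<\min\{k_1|L_0|^2/2,\ k_2(\mu-|A_0|)^2/2\}$, every trajectory of $$\dot x = v - k_1 v\times\Delta L - k_2\Big(v\times(\Delta A\times v)-\tfrac{\mu}{|x|}\Delta A+\tfrac{\mu}{|x|^3}xx^T\Delta A\Big),$$ $$\dot v = -\mu\tfrac{x}{|x|^3} - k_1\Delta L\times x - k_2\big((x\times v)\times\Delta A + x\times(v\times\Delta A)\big),$$ with $\Delta L=L(x,v)-L_0$, $\Delta A=A(x,v)-A_0$, starting in $V^{-1}([0,c])$ stays in $V^{-1}([0,c])$ for all $t\ge0$ and converges as $t\to\infty$ to $V^{-1}(0)=\{(x,v): L(x,v)=L_0,\ A(x,v)=A_0\}$. Furthermore $V^{-1}(0)$ is invariant under both this system and the Kepler system $\dot x=v$, $\dot v=-\mu x/|x|^3$.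
   Context: $\mathbb R^3_0=\mathbb R^3\setminus\{0\}$, $\mu>0$, $k_1,k_2>0$. $L(x,v)=x\times v$, $A(x,v)=v\times(x\times v)-\mu x/|x|$ (note $L\perp A$ always). $V(x,v)=\tfrac{k_1}{2}|L(x,v)-L_0|^2+\tfrac{k_2}{2}|A(x,v)-A_0|^2$ on $\mathbb R^3_0\times\mathbb R^3$. *)

(* Defs.v *)
From Stdlib Require Import Reals Lra.
Open Scope R_scope.

Record vec3 := mkV { vx : R; vy : R; vz : R }.

Definition vadd (a b : vec3) := mkV (vx a + vx b) (vy a + vy b) (vz a + vz b).
Definition vsub (a b : vec3) := mkV (vx a - vx b) (vy a - vy b) (vz a - vz b).
Definition vscale (r : R) (a : vec3) := mkV (r * vx a) (r * vy a) (r * vz a).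
Definition vzero := mkV 0 0 0.
Definition dot (a b : vec3) := vx a * vx b + vy a * vy b + vz a * vz b.
Definition cross (a b : vec3) :=
  mkV (vy a * vz b - vz a * vy b) (vz a * vx b - vx a * vz b) (vx a * vy b - vy a * vx b).
Definition vnorm (a : vec3) := sqrt (dot a a).

Definition Lmom (x v : vec3) := cross x v.
Definition Alrl (mu : R) (x v : vec3) :=
  vsub (cross v (cross x v)) (vscale (mu / vnorm x) x).

Definition Vfun (mu k1 k2 : R) (L0 A0 : vec3) (x v : vec3) :=
  k1 / 2 * (vnorm (vsub (Lmom x v) L0)) ^ 2
  + k2 / 2 * (vnorm (vsub (Alrl mu x v) A0)) ^ 2.

Definition ctrl_xdot (mu k1 k2 : R) (L0 A0 x v : vec3) : vec3 :=
  let dL := vsub (Lmom x v) L0 in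
  let dA := vsub (Alrl mu x v) A0 in
  vsub (vsub v (vscale k1 (cross v dL)))
       (vscale k2
          (vadd (vsub (cross v (cross dA v)) (vscale (mu / vnorm x) dA))
                (vscale (mu / (vnorm x ^ 3) * dot x dA) x))).

Definition ctrl_vdot (mu k1 k2 : R) (L0 A0 x v : vec3) : vec3 :=
  let dL := vsub (Lmom x v) L0 in
  let dA := vsub (Alrl mu x v) A0 in
  vsub (vsub (vscale (- mu / (vnorm x ^ 3)) x) (vscale k1 (cross dL x)))
       (vscale k2 (vadd (cross (cross x v) dA) (cross x (cross v dA)))).

Definition kep_xdot (mu : R) (x v : vec3) : vec3 := v.
Definition kep_vdot (mu : R) (x v : vec3) : vec3 := vscale (- mu / (vnorm x ^ 3)) x.

Definition has_deriv3 (f : R -> vec3) (t : R) (d : vec3) : Prop :=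
  derivable_pt_lim (fun s => vx (f s)) t (vx d) /\
  derivable_pt_lim (fun s => vy (f s)) t (vy d) /\
  derivable_pt_lim (fun s => vz (f s)) t (vz d).

(* (x,v) : R -> R^3_0 x R^3 solves  x' = Fx(x,v), v' = Fv(x,v)  on [0,T)
   (T = None means T = +infinity): derivative equation on (0,T),
   right-continuity at 0, and x(t) <> 0 on [0,T). *)
Definition rcont_at0 (f : R -> vec3) : Prop :=
  forall eps, eps > 0 -> exists delta, delta > 0 /\
    forall t, 0 <= t < delta -> vnorm (vsub (f t) (f 0)) < eps.

Definition before (T : option R) (t : R) : Prop :=
  match T with None => True | Some T' => t < T' end.

Definition is_fwd_sol (Fx Fv : vec3 -> vec3 -> vec3) (T : option R)
    (x v : R -> vec3) : Prop :=
  (forall t, 0 < t -> before T t ->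
      has_deriv3 x t (Fx (x t) (v t)) /\ has_deriv3 v t (Fv (x t) (v t))) /\
  rcont_at0 x /\ rcont_at0 v /\
  (forall t, 0 <= t -> before T t -> x t <> vzero).

Definition is_sol_on (Fx Fv : vec3 -> vec3 -> vec3) (a b : R)
    (x v : R -> vec3) : Prop :=
  forall t, a < t < b ->
    x t <> vzero /\
    has_deriv3 x t (Fx (x t) (v t)) /\ has_deriv3 v t (Fv (x t) (v t)).

Definition in_zero_set (mu : R) (L0 A0 x v : vec3) : Prop :=
  x <> vzero /\ Lmom x v = L0 /\ Alrl mu x v = A0.

Definition in_sublevel (mu k1 k2 : R) (L0 A0 : vec3) (c : R) (x v : vec3) : Prop :=
  x <> vzero /\ Vfun mu k1 k2 L0 A0 x v <= c.

Definition dist6 (x v x' v' : vec3) : R :=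
  sqrt (dot (vsub x x') (vsub x x') + dot (vsub v v') (vsub v v')).

(* Main.v *)
Require Import Defs.
From Stdlib Require Import Reals Lra Psatz List Classical ClassicalEpsilon.
From Coquelicot Require Import Coquelicot.
Open Scope R_scope.

(** The controlled system is the Kepler field minus the gradient of [V].  Kepler's
    flow preserves [L] and [A], hence [V], so along a controlled trajectory
    [V' = - |grad V|^2].  The bound on [c] keeps [L] away from [0] and [|A|] away from
    [mu] on the sublevel set; the conic equation [|L|^2 = mu |x| + A . x] and the energy
    identity then confine [(x, v)] to a compact set on which [x] stays away from [0].
    Global existence follows from Picard's theorem for a truncated field.  A critical
    point with [L <> 0] satisfies [(k1 dL, k2 dA) = lam (A, L)], and
    [L . A = L0 . A0 = 0] forces [lam = 0]; so [|grad V|] is bounded below on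
    [V >= eta] by compactness, and [V] tends to [0].  For the invariance of the zero set
    backwards in time, [|grad V|^2 <= C V] locally and Gronwall's lemma applies. *)

(** * Vector algebra and the adjoint of the derivative of (L, A) *)

(** The obstacle is that [(L, A)] is not a submersion: its six components satisfy [L . A = 0], so
    the adjoint of its derivative always kills [(A, L)], and a vanishing gradient does not by itself
    give [dL = dA = 0]. The multiplier [lam] is the trace of this one constraint; for [L <> 0] there
    is no other. A uniform rate of decrease takes the place of an invariance principle: inside the
    sublevel set, as long as [V >= eta], [V] falls at a speed bounded below, so it drops below [eta]
    in finite time. Compactness is then used once more, because small [V] must be turned into small
    distance to the zero set. The singularity at [x = 0] shapes the existence part: the field is
    Lipschitz only away from it, so it is altered there, and the bounds on the sublevel set show
    that the solution never meets the alteration. *)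

Ltac vec_unfold :=
  unfold Lmom, Alrl, vadd, vsub, vscale, vzero, dot, cross in *; cbn [vx vy vz] in *.
Ltac vec_ring :=
  intros; repeat match goal with a : vec3 |- _ => destruct a end; vec_unfold;
  try (f_equal; ring); try ring.

Lemma vec3_eta (a : vec3) : mkV (vx a) (vy a) (vz a) = a.
Proof. now destruct a. Qed.

Lemma vsub_diag (a : vec3) : vsub a a = vzero.
Proof. vec_ring. Qed.

Lemma dot_nonneg (a : vec3) : 0 <= dot a a.
Proof. unfold dot; nra. Qed.

Lemma dot_eq_0 (a : vec3) : dot a a = 0 -> a = vzero.
Proof.
  destruct a as [p q r]; vec_unfold; intro H.
  assert (p = 0) by nra; assert (q = 0) by nra; assert (r = 0) by nra.
  now subst.
Qed.

Lemma dot_pos (a : vec3) : a <> vzero -> 0 < dot a a.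
Proof.
  intro H; destruct (Rle_lt_or_eq_dec _ _ (dot_nonneg a)) as [|E]; auto.
  now destruct H; apply dot_eq_0.
Qed.

Lemma vnorm_nonneg (a : vec3) : 0 <= vnorm a.
Proof. apply sqrt_pos. Qed.

Lemma vnorm_sq (a : vec3) : vnorm a ^ 2 = dot a a.
Proof. apply pow2_sqrt, dot_nonneg. Qed.

Lemma vnorm_zero : vnorm vzero = 0.
Proof. unfold vnorm; replace (dot vzero vzero) with 0 by vec_ring; apply sqrt_0. Qed.

Lemma vnorm_pos (a : vec3) : a <> vzero -> 0 < vnorm a.
Proof. intro H; apply sqrt_lt_R0, dot_pos, H. Qed.

Lemma dot_le_vnorm (a b : vec3) : dot a b <= vnorm a * vnorm b.
Proof.
  unfold vnorm; rewrite <- sqrt_mult; try apply dot_nonneg.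
  apply Rle_trans with (Rabs (dot a b)); [apply Rle_abs|].
  rewrite <- sqrt_Rsqr_abs; apply sqrt_le_1_alt.
  assert (dot a a * dot b b = Rsqr (dot a b) + dot (cross a b) (cross a b))
    by (unfold Rsqr; vec_ring).
  pose proof (dot_nonneg (cross a b)); lra.
Qed.

Lemma vnorm_triangle (a b : vec3) : vnorm (vadd a b) <= vnorm a + vnorm b.
Proof.
  pose proof (vnorm_nonneg a); pose proof (vnorm_nonneg b).
  apply Rsqr_incr_0_var; [|lra].
  rewrite !Rsqr_pow2, vnorm_sq.
  replace (dot (vadd a b) (vadd a b)) with (dot a a + 2 * dot a b + dot b b) by vec_ring.
  rewrite <- !vnorm_sq; pose proof (dot_le_vnorm a b); nra.
Qed.

Lemma vnorm_sub_comm (a b : vec3) : vnorm (vsub a b) = vnorm (vsub b a).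
Proof. unfold vnorm; f_equal; vec_ring. Qed.

Lemma vnorm_le_sub (a b : vec3) : vnorm a <= vnorm b + vnorm (vsub a b).
Proof.
  replace a with (vadd b (vsub a b)) at 1 by vec_ring.
  apply vnorm_triangle.
Qed.

Lemma Rabs_coord_le_vnorm (a : vec3) :
  Rabs (vx a) <= vnorm a /\ Rabs (vy a) <= vnorm a /\ Rabs (vz a) <= vnorm a.
Proof.
  unfold vnorm; rewrite <- !sqrt_Rsqr_abs.
  repeat split; apply sqrt_le_1_alt; unfold Rsqr, dot; nra.
Qed.

Definition invnorm (x : vec3) : R := / vnorm x.

Lemma invnorm_sq (x : vec3) : x <> vzero -> invnorm x ^ 2 * dot x x = 1.
Proof.
  intro H; rewrite <- vnorm_sq; unfold invnorm.
  pose proof (vnorm_pos x H); field; lra.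
Qed.

Lemma invnorm_pos (x : vec3) : x <> vzero -> 0 < invnorm x.
Proof. intro H; apply Rinv_0_lt_compat, vnorm_pos, H. Qed.

(* Throughout, [w] stands for [1/|x|]: with [w] as an extra variable subject to
   [w^2 (x.x) = 1] all vector fields become polynomial. *)
Definition lrl (mu w : R) (x v : vec3) : vec3 :=
  vsub (cross v (cross x v)) (vscale (mu * w) x).

(* [(adjx, adjv)] is the adjoint of the derivative of [(L, A)] at [(x, v)]. *)
Definition adjx (mu w : R) (x v a b : vec3) : vec3 :=
  vadd (cross v a)
    (vadd (vsub (cross v (cross b v)) (vscale (mu * w) b))
          (vscale (mu * w ^ 3 * dot x b) x)).
Definition adjv (x v a b : vec3) : vec3 :=
  vadd (cross a x) (vadd (cross (cross x v) b) (cross x (cross v b))).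

Definition dLmom (x v dx dv : vec3) : vec3 := vadd (cross dx v) (cross x dv).
Definition dlrl (mu w dw : R) (x v dx dv : vec3) : vec3 :=
  vsub (vadd (cross dv (cross x v)) (cross v (dLmom x v dx dv)))
       (vadd (vscale (mu * dw) x) (vscale (mu * w) dx)).

(** The increment [- w ^ 3 * dot x dx] is the derivative of [1/|x|] in the direction [dx], and it
    produces the last term of [adjx]. *)
Lemma adj_spec (mu w : R) (x v a b dx dv : vec3) :
  dot a (dLmom x v dx dv) + dot b (dlrl mu w (- w ^ 3 * dot x dx) x v dx dv)
  = dot (adjx mu w x v a b) dx + dot (adjv x v a b) dv.
Proof. unfold dlrl, dLmom, adjx, adjv; vec_ring. Qed.

(** Conservation of [L] and [A] by Kepler's flow, in dual form: by [adj_spec] the left side pairs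
    [(a, b)] with their derivatives along the Kepler field. It is a multiple of
    [w ^ 2 * dot x x - 1]. *)
Lemma adj_kepler (mu w : R) (x v a b : vec3) :
  w ^ 2 * dot x x = 1 ->
  dot (adjx mu w x v a b) v + dot (adjv x v a b) (vscale (- mu * w ^ 3) x) = 0.
Proof.
  intro H.
  transitivity (mu * w * dot b v * (w ^ 2 * dot x x - 1)).
  - clear H; unfold adjx, adjv; vec_ring.
  - rewrite H; ring.
Qed.

Lemma adj_linear (mu w s : R) (x v a b a' b' : vec3) :
  adjx mu w x v (vsub a (vscale s a')) (vsub b (vscale s b'))
    = vsub (adjx mu w x v a b) (vscale s (adjx mu w x v a' b')) /\
  adjv x v (vsub a (vscale s a')) (vsub b (vscale s b'))
    = vsub (adjv x v a b) (vscale s (adjv x v a' b')).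
Proof. unfold adjx, adjv; split; vec_ring. Qed.

(* The image of [D(L, A)] is the tangent space of [{L . A = 0}], whose normal
   at [(L, A)] is [(A, L)]. *)
Lemma adj_normal (mu w : R) (x v : vec3) :
  adjx mu w x v (lrl mu w x v) (cross x v) = vzero /\
  adjv x v (lrl mu w x v) (cross x v) = vzero.
Proof. unfold adjx, adjv, lrl; split; vec_ring. Qed.

(** Expansion of [b] in the orthogonal frame [x], [cross x l], [l], multiplied by [|x|^2 |l|^2] to
    avoid division. *)
Lemma orthogonal_expansion (x l b : vec3) :
  dot x l = 0 ->
  vscale (dot x x * dot l l) b
  = vadd (vscale (dot l l * dot b x) x)
      (vadd (vscale (dot b (cross x l)) (cross x l)) (vscale (dot x x * dot b l) l)).
Proof.
  intro H.
  (* The version for arbitrary [x] and [l], with a correction divisible by [dot x l], is a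
     polynomial identity. *)
  transitivity (vadd (vadd (vscale (dot l l * dot b x) x)
      (vadd (vscale (dot b (cross x l)) (cross x l)) (vscale (dot x x * dot b l) l)))
      (vscale (dot x l) (vsub (vscale (dot x l) b)
         (vadd (vscale (dot b x) l) (vscale (dot b l) x))))).
  - clear H; vec_ring.
  - rewrite H; clear H; vec_ring.
Qed.

Lemma vscale_inj (s : R) (a b : vec3) : s <> 0 -> vscale s a = vscale s b -> a = b.
Proof.
  intros Hs H; destruct a, b; vec_unfold; injection H; intros.
  f_equal; eapply Rmult_eq_reg_l; eauto.
Qed.

(** The condition [dot b (cross x v) = 0] selects a complement of the line spanned by [(A, L)].
    Pairing the two equations with [x], [v] and [L] forces first [b], then [a], to be parallel to
    [x], and finally both to vanish. *)
Lemma adj_kernel (mu w : R) (x v a b : vec3) :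
  w ^ 2 * dot x x = 1 -> cross x v <> vzero ->
  dot b (cross x v) = 0 ->
  adjx mu w x v a b = vzero -> adjv x v a b = vzero ->
  a = vzero /\ b = vzero.
Proof.
  intros Hw HL HbL E1 E2.
  assert (Hxx : dot x x <> 0) by (intro E; rewrite E in Hw; lra).
  pose proof (dot_pos _ HL) as Hn.
  assert (HxL : dot x (cross x v) = 0) by vec_ring.
  set (n := dot (cross x v) (cross x v)) in *.
  assert (Hnz : dot x x * n <> 0) by (apply Rmult_integral_contrapositive; split; lra).
  assert (Hproj : forall d, dot d (cross x v) = 0 -> dot d (cross x (cross x v)) = 0 ->
    d = vscale (w ^ 2 * dot d x) x).
  { intros d H1 H2; apply (vscale_inj _ _ _ Hnz).
    unfold n at 1; rewrite (orthogonal_expansion x (cross x v) d HxL), H1, H2; fold n.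
    replace (vscale (dot x x * n) (vscale (w ^ 2 * dot d x) x))
      with (vscale (w ^ 2 * dot x x) (vscale (n * dot d x) x)).
    - rewrite Hw; generalize n; clear; vec_ring.
    - generalize n; clear; vec_ring. }
  assert (Hb : b = vscale (w ^ 2 * dot b x) x).
  { apply Hproj; [exact HbL|].
    transitivity (dot x (adjv x v a b)); [clear; unfold adjv; vec_ring|].
    rewrite E2; vec_ring. }
  set (beta := w ^ 2 * dot b x) in *; clearbody beta.
  (* Pairing [adjx] with [x] and [adjv] with [v] gives the same expression except that [beta * n]
     has coefficient 1 in one and 2 in the other; hence [beta = 0]. *)
  assert (S1 : dot a (cross x v) + beta * n = 0).
  { transitivity (dot x (adjx mu w x v a b)
      + mu * w * beta * (dot x x * (1 - w ^ 2 * dot x x))).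
    - rewrite Hb; unfold n, adjx; clear; vec_ring.
    - rewrite E1, Hw; clear; vec_ring. }
  assert (S2 : dot a (cross x v) + 2 * beta * n = 0).
  { transitivity (dot v (adjv x v a b)).
    - rewrite Hb; unfold n, adjv; clear; vec_ring.
    - rewrite E2; clear; vec_ring. }
  assert (Hbeta : beta = 0) by nra.
  assert (Hb0 : b = vzero) by (rewrite Hb, Hbeta; clear; vec_ring).
  split; [|exact Hb0].
  assert (Ha : a = vscale (w ^ 2 * dot a x) x).
  { apply Hproj; [rewrite Hbeta in S1; lra|].
    transitivity (dot (cross x v) (adjv x v a b)).
    - rewrite Hb0; unfold adjv; clear; vec_ring.
    - rewrite E2; clear; vec_ring. }
  set (s := w ^ 2 * dot a x) in *; clearbody s.
  assert (Hs : s * n = 0).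
  { transitivity (- dot (cross x v) (adjx mu w x v a b)).
    - rewrite Ha, Hb0; unfold n, adjx; clear; vec_ring.
    - rewrite E1; clear; vec_ring. }
  assert (s = 0) by nra.
  rewrite Ha, H; clear; vec_ring.
Qed.

Lemma critical_point (mu k1 k2 w : R) (L0 A0 x v : vec3) :
  0 < k1 -> 0 < k2 -> w ^ 2 * dot x x = 1 -> cross x v <> vzero ->
  dot L0 A0 = 0 ->
  let dL := vsub (cross x v) L0 in
  let dA := vsub (lrl mu w x v) A0 in
  adjx mu w x v (vscale k1 dL) (vscale k2 dA) = vzero ->
  adjv x v (vscale k1 dL) (vscale k2 dA) = vzero ->
  dL = vzero /\ dA = vzero.
Proof.
  intros Hk1 Hk2 Hw HL H0 dL dA E1 E2.
  pose proof (dot_pos _ HL) as Hn.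
  set (L := cross x v) in *; set (A := lrl mu w x v) in *.
  (* With this projection coefficient, subtracting [lam] times [(A, L)] makes the second component
     orthogonal to [L], as [adj_kernel] requires. *)
  set (lam := dot (vscale k2 dA) L / dot L L).
  destruct (adj_linear mu w lam x v (vscale k1 dL) (vscale k2 dA) A L) as [F1 F2].
  destruct (adj_normal mu w x v) as [N1 N2]; fold L A in N1, N2.
  rewrite E1, N1 in F1; rewrite E2, N2 in F2.
  destruct (adj_kernel mu w x v (vsub (vscale k1 dL) (vscale lam A))
              (vsub (vscale k2 dA) (vscale lam L)) Hw HL) as [Ha Hb].
  - fold L.
    transitivity (dot (vscale k2 dA) L - lam * dot L L); [clear; vec_ring|].
    unfold lam; field; lra.
  - rewrite F1; vec_ring.
  - rewrite F2; vec_ring.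
  - assert (Ha' : dL = vscale (lam / k1) A).
    { apply (vscale_inj k1); [lra|].
      transitivity (vadd (vsub (vscale k1 dL) (vscale lam A)) (vscale lam A)).
      - clear; vec_ring.
      - rewrite Ha; clear - Hk1; generalize A; vec_ring; f_equal; field; lra. }
    assert (Hb' : dA = vscale (lam / k2) L).
    { apply (vscale_inj k2); [lra|].
      transitivity (vadd (vsub (vscale k2 dA) (vscale lam L)) (vscale lam L)).
      - clear; vec_ring.
      - rewrite Hb; clear - Hk2; generalize L; vec_ring; f_equal; field; lra. }
    assert (HLA : dot L A = 0) by (unfold L, A, lrl; clear; vec_ring).
    (* [L0 . A0 = L . A = 0] forces the Lagrange multiplier [lam] to vanish. *)
    assert (K : lam * (dot L L / k2 + dot A A / k1) = 0).
    { transitivity (dot L A * (1 + lam / k1 * (lam / k2)) - dot (vsub L dL) (vsub A dA)).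
      - rewrite Ha', Hb'; clear - Hk1 Hk2; generalize L A; vec_ring; field; lra.
      - replace (vsub L dL) with L0 by (unfold dL; generalize L; clear; vec_ring).
        replace (vsub A dA) with A0 by (unfold dA; generalize A; clear; vec_ring).
        rewrite H0, HLA; ring. }
    assert (P : 0 < dot L L / k2 + dot A A / k1).
    { apply Rplus_lt_le_0_compat; [now apply Rdiv_lt_0_compat|].
      apply Rmult_le_pos; [apply dot_nonneg|left; now apply Rinv_0_lt_compat]. }
    assert (lam = 0) by nra.
    rewrite Ha', Hb', H; split; unfold Rdiv; rewrite Rmult_0_l; vec_ring.
Qed.

(** * Limits, derivatives and the decrease of V *)

Section Limits.
Context {T : Type} (F : (T -> Prop) -> Prop) {FF : Filter F}.

(** One set of rules serves three filters: [at_right 0] at the initial time, [locally t] at interior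
    times, and [eventually] in the compactness arguments. *)
Definition rlim (f : T -> R) (l : R) : Prop := filterlim f F (locally l).

Definition vlim (f : T -> vec3) (l : vec3) : Prop :=
  rlim (fun t => vx (f t)) (vx l) /\ rlim (fun t => vy (f t)) (vy l) /\
  rlim (fun t => vz (f t)) (vz l).

Lemma rlim_const (l : R) : rlim (fun _ => l) l.
Proof. apply filterlim_const. Qed.

Lemma rlim_plus f g a b : rlim f a -> rlim g b -> rlim (fun t => f t + g t) (a + b).
Proof. intros H K; exact (filterlim_comp_2 _ _ Rplus H K (filterlim_plus a b)). Qed.

Lemma rlim_mult f g a b : rlim f a -> rlim g b -> rlim (fun t => f t * g t) (a * b).
Proof. intros H K; exact (filterlim_comp_2 _ _ Rmult H K (filterlim_mult a b)). Qed.

Lemma rlim_minus f g a b : rlim f a -> rlim g b -> rlim (fun t => f t - g t) (a - b).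
Proof.
  intros H K; apply rlim_plus; [exact H|].
  exact (filterlim_comp _ _ _ g Ropp _ _ _ K (filterlim_opp b)).
Qed.

Lemma rlim_comp f h a : rlim f a -> continuous h a -> rlim (fun t => h (f t)) (h a).
Proof. intros H K; exact (filterlim_comp _ _ _ f h _ _ _ H K). Qed.

Lemma vlim_const l : vlim (fun _ => l) l.
Proof. repeat split; apply rlim_const. Qed.

Lemma vlim_add f g a b : vlim f a -> vlim g b -> vlim (fun t => vadd (f t) (g t)) (vadd a b).
Proof. intros (?&?&?) (?&?&?); repeat split; now apply rlim_plus. Qed.

Lemma vlim_sub f g a b : vlim f a -> vlim g b -> vlim (fun t => vsub (f t) (g t)) (vsub a b).
Proof. intros (?&?&?) (?&?&?); repeat split; now apply rlim_minus. Qed.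

Lemma vlim_scale s f a b : rlim s a -> vlim f b -> vlim (fun t => vscale (s t) (f t)) (vscale a b).
Proof. intros ? (?&?&?); repeat split; now apply rlim_mult. Qed.

Lemma vlim_cross f g a b :
  vlim f a -> vlim g b -> vlim (fun t => cross (f t) (g t)) (cross a b).
Proof. intros (?&?&?) (?&?&?); repeat split; apply rlim_minus; now apply rlim_mult. Qed.

Lemma rlim_dot f g a b : vlim f a -> vlim g b -> rlim (fun t => dot (f t) (g t)) (dot a b).
Proof. intros (?&?&?) (?&?&?); repeat apply rlim_plus; now apply rlim_mult. Qed.

Lemma rlim_vnorm f a : vlim f a -> rlim (fun t => vnorm (f t)) (vnorm a).
Proof. intros H; apply (rlim_comp _ sqrt); [now apply rlim_dot|apply continuous_sqrt]. Qed.

Lemma rlim_invnorm f a : vlim f a -> a <> vzero -> rlim (fun t => invnorm (f t)) (invnorm a).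
Proof.
  intros H Ha; apply (rlim_comp (fun t => vnorm (f t)) Rinv); [now apply rlim_vnorm|].
  apply continuous_Rinv; pose proof (vnorm_pos a Ha); lra.
Qed.

End Limits.

Ltac lim_tac :=
  repeat first [assumption | lazymatch goal with
  | |- rlim _ _ (_ + _) => apply rlim_plus
  | |- rlim _ _ (_ * _) => apply rlim_mult
  | |- rlim _ _ (dot _ _) => apply rlim_dot
  | |- rlim _ _ (vnorm _) => apply rlim_vnorm
  | |- vlim _ _ (vadd _ _) => apply vlim_add
  | |- vlim _ _ (vsub _ _) => apply vlim_sub
  | |- vlim _ _ (vscale _ _) => apply vlim_scale
  | |- vlim _ _ (cross _ _) => apply vlim_cross
  | |- vlim _ _ _ => apply vlim_const
  | |- rlim _ _ _ => apply rlim_const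
  end].

Lemma rcont_at0_vlim (f : R -> vec3) : rcont_at0 f -> vlim (at_right 0) f (f 0).
Proof.
  intro H.
  assert (K : forall p : vec3 -> R,
    (forall a b, p (vsub a b) = p a - p b) -> (forall a, Rabs (p a) <= vnorm a) ->
    rlim (at_right 0) (fun t => p (f t)) (p (f 0))).
  { intros p Hp Hle; apply filterlim_locally; intros eps.
    destruct (H eps (cond_pos eps)) as [d [Hd Hf]].
    exists (mkposreal d Hd); intros t Ht Hpos.
    change (Rabs (t - 0) < d) in Ht; change (Rabs (p (f t) - p (f 0)) < eps).
    rewrite <- Hp; apply Rle_lt_trans with (1 := Hle _), Hf.
    rewrite Rminus_0_r, Rabs_pos_eq in Ht; lra. }
  repeat split; apply K; intros; try reflexivity; apply Rabs_coord_le_vnorm.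
Qed.

Section Derivatives.
Implicit Types (f g : R -> vec3) (t : R).

Lemma is_derive_val (f : R -> R) t d d' : is_derive f t d -> d = d' -> is_derive f t d'.
Proof. now intros ? <-. Qed.

Lemma derivable_pt_lim_val (f : R -> R) t d d' :
  derivable_pt_lim f t d -> d = d' -> derivable_pt_lim f t d'.
Proof. now intros ? <-. Qed.

Lemma is_derive_dot f g t df dg :
  has_deriv3 f t df -> has_deriv3 g t dg ->
  is_derive (fun s => dot (f s) (g s)) t (dot df (g t) + dot (f t) dg).
Proof.
  intros (?&?&?) (?&?&?); apply is_derive_Reals; unfold dot.
  eapply derivable_pt_lim_val.
  - repeat apply derivable_pt_lim_plus; apply derivable_pt_lim_mult; eassumption.
  - cbn; ring.
Qed.

Lemma has_deriv3_cross f g t df dg :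
  has_deriv3 f t df -> has_deriv3 g t dg ->
  has_deriv3 (fun s => cross (f s) (g s)) t (vadd (cross df (g t)) (cross (f t) dg)).
Proof.
  intros (?&?&?) (?&?&?); repeat split; cbn;
    (eapply derivable_pt_lim_val;
     [apply derivable_pt_lim_minus; apply derivable_pt_lim_mult; eassumption|cbn; ring]).
Qed.

Lemma has_deriv3_sub f g t df dg :
  has_deriv3 f t df -> has_deriv3 g t dg ->
  has_deriv3 (fun s => vsub (f s) (g s)) t (vsub df dg).
Proof.
  intros (?&?&?) (?&?&?); repeat split; cbn; now apply derivable_pt_lim_minus.
Qed.

Lemma has_deriv3_const t a : has_deriv3 (fun _ => a) t vzero.
Proof. repeat split; apply derivable_pt_lim_const. Qed.

Lemma has_deriv3_scale (s : R -> R) f t ds df :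
  is_derive s t ds -> has_deriv3 f t df ->
  has_deriv3 (fun u => vscale (s u) (f u)) t (vadd (vscale ds (f t)) (vscale (s t) df)).
Proof.
  intros H (?&?&?); apply is_derive_Reals in H; repeat split; cbn;
    now apply derivable_pt_lim_mult.
Qed.

Lemma is_derive_invnorm f t df :
  has_deriv3 f t df -> f t <> vzero ->
  is_derive (fun s => invnorm (f s)) t (- invnorm (f t) ^ 3 * dot (f t) df).
Proof.
  intros H Hf; pose proof (dot_pos _ Hf) as Hp; pose proof (vnorm_pos _ Hf) as Hn.
  eapply is_derive_val.
  - apply is_derive_inv; [|apply Rgt_not_eq, Hn].
    apply is_derive_comp with (f := sqrt) (g := fun s => dot (f s) (f s)).
    + apply is_derive_Reals, derivable_pt_lim_sqrt, Hp.
    + apply (is_derive_dot f f t df df H H).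
  - replace (dot df (f t)) with (dot (f t) df) by (unfold dot; ring).
    unfold invnorm; fold (vnorm (f t)); unfold scal; simpl; unfold mult; simpl.
    field; lra.
Qed.

Lemma has_deriv3_vlim f t d : has_deriv3 f t d -> vlim (locally t) f (f t).
Proof.
  intros (H1&H2&H3).
  split; [|split]; apply (@ex_derive_continuous R_AbsRing R_NormedModule);
    eexists; apply is_derive_Reals; eassumption.
Qed.
End Derivatives.

Lemma nonincreasing_of_derive_nonpos (y dy : R -> R) (a b : R) :
  a <= b -> (forall t, a <= t <= b -> is_derive y t (dy t)) ->
  (forall t, a <= t <= b -> dy t <= 0) -> y b <= y a.
Proof.
  intros Hab Hd Hn.
  destruct (MVT_gen y a b dy) as [s [Hs E]].
  - intros t Ht; rewrite Rmin_left, Rmax_right in Ht by lra; apply Hd; lra.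
  - intros t Ht; rewrite Rmin_left, Rmax_right in Ht by lra.
    apply derivable_continuous_pt; exists (dy t); apply is_derive_Reals, Hd; lra.
  - rewrite Rmin_left, Rmax_right in Hs by lra; specialize (Hn s ltac:(lra)); nra.
Qed.

(** * The gradient of [V] and the monotonicity of [V] *)

Section Potential.
Variables (mu k1 k2 : R) (L0 A0 : vec3).

Let V := Vfun mu k1 k2 L0 A0.

(** Chain rule: the adjoint of the derivative of [(L, A)] applied to [(k1 dL, k2 dA)]. That this is
    the gradient is confirmed by [is_derive_Vfun]. *)
Definition gradx (x v : vec3) : vec3 :=
  adjx mu (invnorm x) x v (vscale k1 (vsub (Lmom x v) L0)) (vscale k2 (vsub (Alrl mu x v) A0)).
Definition gradv (x v : vec3) : vec3 :=
  adjv x v (vscale k1 (vsub (Lmom x v) L0)) (vscale k2 (vsub (Alrl mu x v) A0)).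
Definition gradsq (x v : vec3) : R :=
  dot (gradx x v) (gradx x v) + dot (gradv x v) (gradv x v).

Lemma gradsq_nonneg x v : 0 <= gradsq x v.
Proof. apply Rplus_le_le_0_compat; apply dot_nonneg. Qed.

Lemma Vfun_dot x v : V x v =
  k1 / 2 * dot (vsub (Lmom x v) L0) (vsub (Lmom x v) L0)
  + k2 / 2 * dot (vsub (Alrl mu x v) A0) (vsub (Alrl mu x v) A0).
Proof. unfold V, Vfun; now rewrite !vnorm_sq. Qed.

Lemma kep_vdot_invnorm x v : kep_vdot mu x v = vscale (- mu * invnorm x ^ 3) x.
Proof. unfold kep_vdot, invnorm, Rdiv; now rewrite pow_inv. Qed.

Lemma ctrl_xdot_grad x v : ctrl_xdot mu k1 k2 L0 A0 x v = vsub v (gradx x v).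
Proof.
  unfold ctrl_xdot, gradx, adjx, Rdiv; cbv zeta.
  rewrite <- pow_inv; fold (invnorm x).
  generalize (invnorm x) (vsub (Lmom x v) L0) (vsub (Alrl mu x v) A0); clear L0 A0 V; vec_ring.
Qed.

Lemma ctrl_vdot_grad x v :
  ctrl_vdot mu k1 k2 L0 A0 x v = vsub (vscale (- mu * invnorm x ^ 3) x) (gradv x v).
Proof.
  unfold ctrl_vdot, gradv, adjv, Rdiv; cbv zeta.
  rewrite <- pow_inv; fold (invnorm x).
  generalize (invnorm x) (vsub (Lmom x v) L0) (vsub (Alrl mu x v) A0); clear L0 A0 V; vec_ring.
Qed.

Lemma rlim_Vfun {T} (F : (T -> Prop) -> Prop) {FF : Filter F} (x v : T -> vec3) lx lv :
  vlim F x lx -> vlim F v lv -> lx <> vzero -> rlim F (fun t => V (x t) (v t)) (V lx lv).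
Proof.
  intros Hx Hv H; unfold V, Vfun, Lmom, Alrl, Rdiv, pow.
  pose proof (rlim_invnorm F x lx Hx H) as Hw; unfold invnorm in Hw.
  lim_tac.
Qed.

Lemma rlim_gradsq {T} (F : (T -> Prop) -> Prop) {FF : Filter F} (x v : T -> vec3) lx lv :
  vlim F x lx -> vlim F v lv -> lx <> vzero ->
  rlim F (fun t => gradsq (x t) (v t)) (gradsq lx lv).
Proof.
  intros Hx Hv H.
  pose proof (rlim_invnorm F x lx Hx H) as Hw.
  assert (Ha : vlim F (fun t => vscale k1 (vsub (Lmom (x t) (v t)) L0))
                 (vscale k1 (vsub (Lmom lx lv) L0))).
  { unfold Lmom; lim_tac. }
  assert (Hb : vlim F (fun t => vscale k2 (vsub (Alrl mu (x t) (v t)) A0))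
                 (vscale k2 (vsub (Alrl mu lx lv) A0))).
  { unfold invnorm in Hw; unfold Alrl, Rdiv.
    lim_tac. }
  assert (Hgx : vlim F (fun t => gradx (x t) (v t)) (gradx lx lv)).
  { unfold gradx, adjx, pow.
    lim_tac. }
  assert (Hgv : vlim F (fun t => gradv (x t) (v t)) (gradv lx lv)).
  { unfold gradv, adjv.
    lim_tac. }
  unfold gradsq; lim_tac.
Qed.

(** The curve is arbitrary, so the formula serves both the controlled and the Kepler system. *)
Lemma is_derive_Vfun (x v : R -> vec3) t dx dv :
  has_deriv3 x t dx -> has_deriv3 v t dv -> x t <> vzero ->
  is_derive (fun s => V (x s) (v s)) t
    (dot (gradx (x t) (v t)) dx + dot (gradv (x t) (v t)) dv).
Proof.
  intros Hx Hv H.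
  apply is_derive_ext with (f := fun s =>
    k1 / 2 * dot (vsub (Lmom (x s) (v s)) L0) (vsub (Lmom (x s) (v s)) L0)
    + k2 / 2 * dot (vsub (Alrl mu (x s) (v s)) A0) (vsub (Alrl mu (x s) (v s)) A0)).
  { intro s; symmetry; apply Vfun_dot. }
  assert (HL : has_deriv3 (fun s => vsub (Lmom (x s) (v s)) L0) t
                 (vsub (dLmom (x t) (v t) dx dv) vzero)).
  { apply has_deriv3_sub; [|apply has_deriv3_const].
    apply (has_deriv3_cross x v t dx dv Hx Hv). }
  assert (HA : has_deriv3 (fun s => vsub (Alrl mu (x s) (v s)) A0) t
    (vsub (dlrl mu (invnorm (x t)) (- invnorm (x t) ^ 3 * dot (x t) dx)
             (x t) (v t) dx dv) vzero)).
  { apply has_deriv3_sub; [|apply has_deriv3_const].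
    unfold Alrl; apply has_deriv3_sub.
    - apply (has_deriv3_cross v (fun s => cross (x s) (v s)) t dv _ Hv).
      apply (has_deriv3_cross x v t dx dv Hx Hv).
    - apply (has_deriv3_scale (fun s => mu / vnorm (x s)) x t); [|exact Hx].
      apply (is_derive_scal (fun s => invnorm (x s)) t mu).
      now apply is_derive_invnorm. }
  eapply is_derive_val.
  - apply (is_derive_plus (V := R_NormedModule)).
    + apply (is_derive_scal _ t (k1 / 2)), (is_derive_dot _ _ t _ _ HL HL).
    + apply (is_derive_scal _ t (k2 / 2)), (is_derive_dot _ _ t _ _ HA HA).
  - unfold gradx, gradv; rewrite <- adj_spec.
    generalize (dLmom (x t) (v t) dx dv).
    generalize (dlrl mu (invnorm (x t)) (- invnorm (x t) ^ 3 * dot (x t) dx)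
      (x t) (v t) dx dv).
    generalize (vsub (Lmom (x t) (v t)) L0) (vsub (Alrl mu (x t) (v t)) A0).
    unfold plus; simpl; intros [] [] [] []; vec_unfold; field.
Qed.

Lemma grad_kepler x v : x <> vzero ->
  dot (gradx x v) v + dot (gradv x v) (vscale (- mu * invnorm x ^ 3) x) = 0.
Proof. intro H; apply adj_kepler, invnorm_sq, H. Qed.

Lemma is_derive_Vfun_ctrl (x v : R -> vec3) t :
  has_deriv3 x t (ctrl_xdot mu k1 k2 L0 A0 (x t) (v t)) ->
  has_deriv3 v t (ctrl_vdot mu k1 k2 L0 A0 (x t) (v t)) -> x t <> vzero ->
  is_derive (fun s => V (x s) (v s)) t (- gradsq (x t) (v t)).
Proof.
  intros Hx Hv H; eapply is_derive_val; [now apply is_derive_Vfun; eauto|].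
  rewrite ctrl_xdot_grad, ctrl_vdot_grad; pose proof (grad_kepler (x t) (v t) H) as K.
  revert K; unfold gradsq; generalize (vscale (- mu * invnorm (x t) ^ 3) (x t)).
  generalize (gradx (x t) (v t)) (gradv (x t) (v t)); generalize (v t).
  intros [] [] [] []; vec_unfold; lra.
Qed.

Lemma is_derive_Vfun_kep (x v : R -> vec3) t :
  has_deriv3 x t (kep_xdot mu (x t) (v t)) ->
  has_deriv3 v t (kep_vdot mu (x t) (v t)) -> x t <> vzero ->
  is_derive (fun s => V (x s) (v s)) t 0.
Proof.
  intros Hx Hv H; eapply is_derive_val; [now apply is_derive_Vfun; eauto|].
  rewrite kep_vdot_invnorm; now apply grad_kepler.
Qed.

Hypotheses (Hk1 : 0 < k1) (Hk2 : 0 < k2).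

Lemma Vfun_nonneg x v : 0 <= V x v.
Proof.
  rewrite Vfun_dot; apply Rplus_le_le_0_compat; apply Rmult_le_pos;
    try apply dot_nonneg; lra.
Qed.

(** The form [V x v <= 0] is the one delivered by monotonicity, by Gronwall and by limits, all of
    which give upper bounds. *)
Lemma Vfun_eq_0 x v : x <> vzero -> V x v <= 0 <-> in_zero_set mu L0 A0 x v.
Proof.
  intro H; unfold in_zero_set; rewrite Vfun_dot; split.
  - intro K; pose proof (dot_nonneg (vsub (Lmom x v) L0));
      pose proof (dot_nonneg (vsub (Alrl mu x v) A0)).
    assert (E1 : dot (vsub (Lmom x v) L0) (vsub (Lmom x v) L0) = 0) by nra.
    assert (E2 : dot (vsub (Alrl mu x v) A0) (vsub (Alrl mu x v) A0) = 0) by nra.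
    apply dot_eq_0 in E1, E2; revert E1 E2.
    generalize (Lmom x v) (Alrl mu x v); intros [] []; destruct L0, A0; vec_unfold.
    intros E1 E2; injection E1; injection E2; intros.
    repeat split; [exact H|f_equal; lra|f_equal; lra].
  - intros (_&->&->); rewrite !vsub_diag; vec_unfold; right; ring.
Qed.

Lemma Vfun_antitone (T : option R) (x v : R -> vec3) :
  is_fwd_sol (ctrl_xdot mu k1 k2 L0 A0) (ctrl_vdot mu k1 k2 L0 A0) T x v ->
  forall s t, 0 <= s <= t -> before T t -> V (x t) (v t) <= V (x s) (v s).
Proof.
  intros (Hd&Hcx&Hcv&Hx) s t Hst Ht.
  assert (Hb : forall u, u <= t -> before T u) by (intros; destruct T; simpl in *; lra).
  assert (P : forall s, 0 < s <= t -> V (x t) (v t) <= V (x s) (v s)).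
  { clear s Hst; intros s Hs.
    apply (nonincreasing_of_derive_nonpos (fun u => V (x u) (v u))
             (fun u => - gradsq (x u) (v u))); [lra| |].
    - intros u Hu; destruct (Hd u) as [H1 H2]; [lra|apply Hb; lra|].
      apply is_derive_Vfun_ctrl; auto; apply Hx; [lra|apply Hb; lra].
    - intros u _; pose proof (gradsq_nonneg (x u) (v u)); lra. }
  destruct (Req_dec s 0) as [->|Hs]; [|apply P; lra].
  destruct (Req_dec t 0) as [->|Ht0]; [lra|].
  (* At time 0 only right-continuity is available, so the inequality for [s > 0] is carried to
     [s = 0] by a one-sided limit. *)
  refine (filterlim_le (F := at_right 0) (fun _ => V (x t) (v t))
            (fun s => V (x s) (v s)) (V (x t) (v t)) (V (x 0) (v 0)) _ _ _).
  - assert (Htp : 0 < t) by lra.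
    exists (mkposreal t Htp); intros u Hu Hpos; apply P.
    change (Rabs (u - 0) < t) in Hu; rewrite Rminus_0_r, Rabs_pos_eq in Hu; lra.
  - apply filterlim_const.
  - apply rlim_Vfun; [typeclasses eauto|now apply rcont_at0_vlim|now apply rcont_at0_vlim|].
    apply Hx; [lra|apply Hb; lra].
Qed.

End Potential.

(** * Bounds on sublevel sets and invariance of the zero set *)

Lemma vnorm_cross_le (a b : vec3) : vnorm (cross a b) <= vnorm a * vnorm b.
Proof.
  unfold vnorm; rewrite <- sqrt_mult; try apply dot_nonneg.
  apply sqrt_le_1_alt.
  assert (dot a a * dot b b = dot a b * dot a b + dot (cross a b) (cross a b)) by vec_ring.
  nra.
Qed.

Lemma vnorm_scale (s : R) (a : vec3) : vnorm (vscale s a) = Rabs s * vnorm a.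
Proof.
  unfold vnorm; rewrite <- (sqrt_Rsqr_abs s), <- sqrt_mult;
    [|apply Rle_0_sqr|apply dot_nonneg].
  f_equal; unfold Rsqr; vec_ring.
Qed.

Lemma vnorm_sub_le (a b : vec3) : vnorm (vsub a b) <= vnorm a + vnorm b.
Proof.
  replace (vsub a b) with (vadd a (vscale (-1) b)) by vec_ring.
  apply Rle_trans with (1 := vnorm_triangle _ _); rewrite vnorm_scale, Rabs_left; lra.
Qed.

Lemma Rabs_dot_le (a b : vec3) : Rabs (dot a b) <= vnorm a * vnorm b.
Proof.
  apply Rabs_le; split; [|apply dot_le_vnorm].
  pose proof (dot_le_vnorm (vscale (-1) a) b) as H.
  rewrite vnorm_scale, Rabs_left in H by lra.
  replace (dot (vscale (-1) a) b) with (- dot a b) in H by vec_ring; lra.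
Qed.

Lemma invnorm_vnorm (x : vec3) : x <> vzero -> invnorm x * vnorm x = 1.
Proof. intro H; apply Rinv_l; pose proof (vnorm_pos x H); lra. Qed.

Lemma lrl_dot_position (mu : R) (x v : vec3) : x <> vzero ->
  dot (Alrl mu x v) x = dot (Lmom x v) (Lmom x v) - mu * vnorm x.
Proof.
  intro H; unfold Alrl.
  replace (mu * vnorm x) with (mu / vnorm x * dot x x)
    by (rewrite <- vnorm_sq; field; pose proof (vnorm_pos x H); lra).
  generalize (mu / vnorm x); clear; vec_ring.
Qed.

(** The factor [dot v v - 2 * mu / vnorm x] is twice the Kepler energy. Hence [|A| < mu] with
    [L <> 0] forces negative energy, which bounds the speed. *)
Lemma lrl_sq (mu : R) (x v : vec3) : x <> vzero ->
  dot (Alrl mu x v) (Alrl mu x v)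
  = mu ^ 2 + (dot v v - 2 * mu / vnorm x) * dot (Lmom x v) (Lmom x v).
Proof.
  intro H; pose proof (invnorm_sq x H) as E.
  unfold Alrl, Rdiv; fold (invnorm x); revert E; generalize (invnorm x); intros w E.
  transitivity (mu ^ 2 * (w ^ 2 * dot x x)
                + (dot v v - 2 * mu * w) * dot (Lmom x v) (Lmom x v)).
  - clear; vec_ring.
  - rewrite E; ring.
Qed.

(** The bound [s] is uniform in [y], so [n - s] is a fixed margin: it will separate [|L|] from 0 and
    [|A|] from [mu]. *)
Lemma sqrt_gap (q n : R) : 0 <= q -> q < n ^ 2 -> 0 <= n ->
  exists s, s < n /\ forall y, 0 <= y -> y ^ 2 <= q -> y <= s.
Proof.
  intros Hq Hn Hn0; exists (sqrt q); split.
  - rewrite <- (sqrt_pow2 n Hn0); apply sqrt_lt_1_alt; lra.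
  - intros y Hy H; rewrite <- (sqrt_pow2 y Hy); now apply sqrt_le_1_alt.
Qed.

Lemma sublevel_bounds (mu k1 k2 c : R) (L0 A0 : vec3) :
  0 < mu -> 0 < k1 -> 0 < k2 -> 0 < c -> vnorm A0 < mu ->
  c < k1 * vnorm L0 ^ 2 / 2 -> c < k2 * (mu - vnorm A0) ^ 2 / 2 ->
  exists r M, 0 < r /\ 0 < M /\ forall x v, in_sublevel mu k1 k2 L0 A0 c x v ->
    r <= vnorm x /\ vnorm x <= M /\ vnorm v <= M /\ Lmom x v <> vzero.
Proof.
  intros Hmu Hk1 Hk2 Hc HA H1 H2.
  pose proof (vnorm_nonneg L0) as HL0; pose proof (vnorm_nonneg A0) as HA0.
  assert (Hq1 : 2 * c / k1 < vnorm L0 ^ 2).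
  { apply Rmult_lt_reg_r with k1; auto; unfold Rdiv; rewrite Rmult_assoc, Rinv_l; lra. }
  assert (Hq2 : 2 * c / k2 < (mu - vnorm A0) ^ 2).
  { apply Rmult_lt_reg_r with k2; auto; unfold Rdiv; rewrite Rmult_assoc, Rinv_l; lra. }
  destruct (sqrt_gap (2 * c / k1) (vnorm L0)) as [s1 [Hs1 B1]]; auto.
  { left; apply Rdiv_lt_0_compat; lra. }
  destruct (sqrt_gap (2 * c / k2) (mu - vnorm A0)) as [s2 [Hs2 B2]]; auto; try lra.
  { left; apply Rdiv_lt_0_compat; lra. }
  (* On the sublevel set [|L| >= l] and [mu - |A| >= d]. *)
  set (l := vnorm L0 - s1); set (d := mu - vnorm A0 - s2).
  assert (Hl : 0 < l) by (unfold l; lra); assert (Hd : 0 < d) by (unfold d; lra).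
  (* From [l^2 <= |L|^2 = mu |x| + A . x <= 2 mu |x|]. *)
  set (r := l ^ 2 / (2 * mu)).
  assert (Hr : 0 < r) by (apply Rdiv_lt_0_compat; nra).
  (* From [d |x| <= (mu - |A|) |x| <= |L|^2] and [|L| <= |L0| + s1 <= 2 |L0|]. *)
  set (RR := (2 * vnorm L0) ^ 2 / d).
  set (m := 2 * mu / r).
  assert (Hm : 0 < m) by (apply Rdiv_lt_0_compat; lra).
  assert (HRR : 0 <= RR) by (apply Rdiv_le_0_compat; nra).
  (* Nonpositive energy gives [|v|^2 <= 2 mu / |x| <= m]. Since [m] bounds the square of the speed,
     the [+ 1] is added to bound the speed itself. *)
  exists r, (RR + m + 1); split; [exact Hr|split; [lra|]].
  intros x v [Hx HV].
  pose proof (vnorm_nonneg (vsub (Lmom x v) L0)) as P1.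
  pose proof (vnorm_nonneg (vsub (Alrl mu x v) A0)) as P2.
  assert (D1 : vnorm (vsub (Lmom x v) L0) <= s1).
  { apply B1; auto; apply Rmult_le_reg_r with (k1 / 2); [lra|]; unfold Vfun in HV.
    replace (2 * c / k1 * (k1 / 2)) with c by (field; lra); nra. }
  assert (D2 : vnorm (vsub (Alrl mu x v) A0) <= s2).
  { apply B2; auto; apply Rmult_le_reg_r with (k2 / 2); [lra|]; unfold Vfun in HV.
    replace (2 * c / k2 * (k2 / 2)) with c by (field; lra); nra. }
  pose proof (vnorm_le_sub L0 (Lmom x v)) as T1; rewrite vnorm_sub_comm in T1.
  pose proof (vnorm_le_sub (Lmom x v) L0) as T2.
  pose proof (vnorm_le_sub (Alrl mu x v) A0) as T3.
  pose proof (vnorm_nonneg (Alrl mu x v)) as P3.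
  pose proof (vnorm_pos x Hx) as Hn.
  assert (Hl1 : l <= vnorm (Lmom x v)) by (unfold l; lra).
  assert (Hl2 : vnorm (Lmom x v) <= 2 * vnorm L0) by lra.
  assert (Ha1 : vnorm (Alrl mu x v) <= mu - d) by (unfold d; lra).
  clearbody l d; clear B1 B2 HV T1 T2 T3 D1 D2 P1 P2.
  pose proof (Rabs_dot_le (Alrl mu x v) x) as C.
  rewrite (lrl_dot_position mu x v Hx), <- vnorm_sq in C; apply Rabs_le_between in C.
  assert (Hr1 : r <= vnorm x).
  { unfold r; apply Rmult_le_reg_r with (2 * mu); [lra|]; unfold Rdiv.
    rewrite Rmult_assoc, Rinv_l by lra; nra. }
  assert (HR1 : vnorm x <= RR).
  { unfold RR; apply Rmult_le_reg_r with d; [lra|]; unfold Rdiv.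
    rewrite Rmult_assoc, Rinv_l by lra; nra. }
  assert (Hv : vnorm v ^ 2 <= m).
  { pose proof (lrl_sq mu x v Hx) as E; rewrite <- !vnorm_sq in E.
    assert (K : vnorm v ^ 2 - 2 * mu / vnorm x <= 0).
    { apply Rmult_le_reg_r with (vnorm (Lmom x v) ^ 2); nra. }
    assert (2 * mu / vnorm x <= m); [|lra].
    unfold m; apply Rmult_le_compat_l; [lra|]; now apply Rinv_le_contravar. }
  repeat split; try lra.
  - pose proof (vnorm_nonneg v); nra.
  - intro E; rewrite E, vnorm_zero in Hl1; lra.
Qed.

(** The gradient is linear in [(dL, dA)] with coefficients bounded on the region, while [V] is a
    positive definite quadratic form in them. This is the differential inequality that Gronwall
    needs backwards in time. *)
Lemma gradsq_le_Vfun (mu k1 k2 B : R) (L0 A0 : vec3) :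
  0 < mu -> 0 < k1 -> 0 < k2 ->
  exists C, 0 <= C /\ forall x v, x <> vzero ->
    vnorm x <= B -> vnorm v <= B -> invnorm x <= B ->
    gradsq mu k1 k2 L0 A0 x v <= C * Vfun mu k1 k2 L0 A0 x v.
Proof.
  intros Hmu Hk1 Hk2.
  (* [D] dominates the coefficients of both adjoint components: [B] from the [a]-terms, [2 * B ^ 2]
     from the double products, [2 * mu * B] from the two singular terms, where
     [w ^ 3 * |x|^2 = w]. *)
  set (D := B + 2 * B ^ 2 + 2 * mu * B).
  (* The 8 collects a 2 for the two components, a 2 from squaring [|a| + |b|], and a 2 from the
     halves in [V]; [k1 + k2] dominates the extra factor [k1] or [k2]. *)
  exists (8 * D ^ 2 * (k1 + k2)); split.
  { pose proof (pow2_ge_0 D); nra. }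
  intros x v Hx Bx Bv Bw.
  pose proof (vnorm_pos x Hx) as Px; pose proof (vnorm_nonneg v) as Pv.
  pose proof (invnorm_pos x Hx) as Pw.
  assert (PB : 0 < B) by lra; pose proof (Rmult_lt_0_compat _ _ Hmu PB) as PmB.
  pose proof (pow2_ge_0 B) as PB2.
  unfold gradsq, gradx, gradv.
  rewrite Vfun_dot, <- !vnorm_sq.
  set (dL := vsub (Lmom x v) L0); set (dA := vsub (Alrl mu x v) A0).
  set (a := vscale k1 dL); set (b := vscale k2 dA).
  pose proof (vnorm_nonneg a) as Pa; pose proof (vnorm_nonneg b) as Pb.
  assert (G1 : vnorm (adjx mu (invnorm x) x v a b) <= D * (vnorm a + vnorm b)).
  { unfold adjx.
    apply Rle_trans with (1 := vnorm_triangle _ _).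
    apply Rle_trans with (B * vnorm a + ((B ^ 2 * vnorm b + mu * B * vnorm b)
                                          + mu * B * vnorm b)).
    - apply Rplus_le_compat.
      { apply Rle_trans with (1 := vnorm_cross_le _ _); nra. }
      apply Rle_trans with (1 := vnorm_triangle _ _).
      apply Rplus_le_compat.
      + apply Rle_trans with (1 := vnorm_sub_le _ _).
        apply Rplus_le_compat.
        * apply Rle_trans with (1 := vnorm_cross_le _ _).
          pose proof (vnorm_cross_le b v); pose proof (vnorm_nonneg (cross b v)).
          apply Rle_trans with (B * (vnorm b * B)); [|right; ring].
          apply Rmult_le_compat; nra.
        * rewrite vnorm_scale, Rabs_pos_eq by nra.
          apply Rmult_le_compat_r; nra.
      + rewrite vnorm_scale, Rabs_mult, (Rabs_pos_eq (mu * invnorm x ^ 3))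
          by (apply Rmult_le_pos; [lra|apply pow_le; lra]).
        pose proof (Rabs_dot_le x b).
        apply Rle_trans with (mu * invnorm x ^ 3 * (vnorm x * vnorm b) * vnorm x).
        * apply Rmult_le_compat_r; [lra|]; apply Rmult_le_compat_l; [|lra].
          apply Rmult_le_pos; [lra|apply pow_le; lra].
        * replace (mu * invnorm x ^ 3 * (vnorm x * vnorm b) * vnorm x)
            with (mu * invnorm x * vnorm b * (invnorm x * vnorm x) ^ 2) by ring.
          rewrite (invnorm_vnorm x Hx), pow1, Rmult_1_r.
          apply Rmult_le_compat_r; nra.
    - unfold D; pose proof (Rmult_le_pos _ _ PB2 Pa); pose proof (Rmult_le_pos _ _ PB2 Pb).
      pose proof (Rmult_le_pos _ _ (Rlt_le _ _ PmB) Pa).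
      pose proof (Rmult_le_pos _ _ (Rlt_le _ _ PmB) Pb).
      pose proof (Rmult_le_pos _ _ (Rlt_le _ _ PB) Pb); lra. }
  assert (G2 : vnorm (adjv x v a b) <= D * (vnorm a + vnorm b)).
  { unfold adjv.
    apply Rle_trans with (1 := vnorm_triangle _ _).
    apply Rle_trans with (B * vnorm a + (B ^ 2 * vnorm b + B ^ 2 * vnorm b)).
    - apply Rplus_le_compat.
      { apply Rle_trans with (1 := vnorm_cross_le _ _); nra. }
      apply Rle_trans with (1 := vnorm_triangle _ _).
      apply Rplus_le_compat.
      + apply Rle_trans with (1 := vnorm_cross_le _ _).
        pose proof (vnorm_cross_le x v); pose proof (vnorm_nonneg (cross x v)).
        apply Rmult_le_compat_r; nra.
      + apply Rle_trans with (1 := vnorm_cross_le _ _).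
        pose proof (vnorm_cross_le v b); pose proof (vnorm_nonneg (cross v b)).
        apply Rle_trans with (B * (B * vnorm b)); [|right; ring].
        apply Rmult_le_compat; nra.
    - unfold D; pose proof (Rmult_le_pos _ _ PB2 Pa); pose proof (Rmult_le_pos _ _ PB2 Pb).
      pose proof (Rmult_le_pos _ _ (Rlt_le _ _ PmB) Pa).
      pose proof (Rmult_le_pos _ _ (Rlt_le _ _ PmB) Pb).
      pose proof (Rmult_le_pos _ _ (Rlt_le _ _ PB) Pb); lra. }
  assert (Ea : vnorm a ^ 2 = k1 ^ 2 * vnorm dL ^ 2)
    by (unfold a; rewrite vnorm_scale, Rabs_pos_eq; [ring|lra]).
  assert (Eb : vnorm b ^ 2 = k2 ^ 2 * vnorm dA ^ 2)
    by (unfold b; rewrite vnorm_scale, Rabs_pos_eq; [ring|lra]).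
  apply Rle_trans with (2 * (D * (vnorm a + vnorm b)) ^ 2).
  { pose proof (pow_incr _ _ 2 (conj (vnorm_nonneg _) G1)).
    pose proof (pow_incr _ _ 2 (conj (vnorm_nonneg _) G2)); lra. }
  apply Rle_trans with (4 * D ^ 2 * (vnorm a ^ 2 + vnorm b ^ 2)).
  { replace (2 * (D * (vnorm a + vnorm b)) ^ 2)
      with (2 * D ^ 2 * (vnorm a + vnorm b) ^ 2) by ring.
    pose proof (pow2_ge_0 D).
    replace (4 * D ^ 2 * (vnorm a ^ 2 + vnorm b ^ 2))
      with (2 * D ^ 2 * (2 * (vnorm a ^ 2 + vnorm b ^ 2))) by ring.
    apply Rmult_le_compat_l; [lra|]; pose proof (pow2_ge_0 (vnorm a - vnorm b)); lra. }
  rewrite Ea, Eb.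
  pose proof (pow2_ge_0 (vnorm dL)) as Q1; pose proof (pow2_ge_0 (vnorm dA)) as Q2.
  replace (8 * D ^ 2 * (k1 + k2) * (k1 / 2 * vnorm dL ^ 2 + k2 / 2 * vnorm dA ^ 2))
    with (4 * D ^ 2 * ((k1 + k2) * (k1 * vnorm dL ^ 2 + k2 * vnorm dA ^ 2))) by field.
  apply Rmult_le_compat_l; [pose proof (pow2_ge_0 D); lra|].
  assert (0 <= k1 * k2 * vnorm dL ^ 2) by (apply Rmult_le_pos; [nra|assumption]).
  assert (0 <= k1 * k2 * vnorm dA ^ 2) by (apply Rmult_le_pos; [nra|assumption]).
  lra.
Qed.

(** The differential inequality makes [exp (C * u) * y u] nondecreasing, so it cannot be positive at
    [s] and nonpositive at [t]. *)
Lemma zero_backward (y dy : R -> R) (C s t : R) :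
  s <= t -> (forall u, s <= u <= t -> is_derive y u (dy u)) ->
  (forall u, s <= u <= t -> - C * y u <= dy u) -> y t <= 0 -> y s <= 0.
Proof.
  intros Hst Hd Hle Ht.
  assert (H : - (exp (C * t) * y t) <= - (exp (C * s) * y s)).
  { apply (nonincreasing_of_derive_nonpos (fun u => - (exp (C * u) * y u))
      (fun u => - (exp (C * u) * (C * y u + dy u))) s t Hst).
    - intros u Hu; auto_derive.
      + exists (dy u); now apply Hd.
      + replace (Derive (fun x => y x) u) with (dy u)
          by (symmetry; apply is_derive_unique; now apply Hd).
        ring.
    - intros u Hu; specialize (Hle u Hu); pose proof (exp_pos (C * u)); nra. }
  pose proof (exp_pos (C * t)); pose proof (exp_pos (C * s)); nra.
Qed.

Lemma continuous_bounded_above (f : R -> R) (s t : R) :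
  s <= t -> (forall u, s <= u <= t -> rlim (locally u) f (f u)) ->
  exists B, forall u, s <= u <= t -> f u <= B.
Proof.
  intros Hst Hf; destruct (continuity_ab_maj f s t Hst) as [m [Hm _]].
  - intros u Hu; apply continuity_pt_filterlim, Hf, Hu.
  - exists (f m); exact Hm.
Qed.

Lemma zero_set_invariant_ctrl (mu k1 k2 a b t0 : R) (L0 A0 : vec3) (x v : R -> vec3) :
  0 < mu -> 0 < k1 -> 0 < k2 ->
  is_sol_on (ctrl_xdot mu k1 k2 L0 A0) (ctrl_vdot mu k1 k2 L0 A0) a b x v ->
  a < t0 < b -> in_zero_set mu L0 A0 (x t0) (v t0) ->
  forall t, a < t < b -> in_zero_set mu L0 A0 (x t) (v t).
Proof.
  intros Hmu Hk1 Hk2 Hs Ht0 H0 t Ht.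
  assert (Hx : forall u, a < u < b -> x u <> vzero) by (intros; now apply Hs).
  apply (Vfun_eq_0 mu k1 k2 L0 A0) in H0; auto.
  apply (Vfun_eq_0 mu k1 k2 L0 A0); auto.
  assert (Hd : forall u, a < u < b -> is_derive (fun s => Vfun mu k1 k2 L0 A0 (x s) (v s)) u
                                   (- gradsq mu k1 k2 L0 A0 (x u) (v u))).
  { intros u Hu; destruct (Hs u Hu) as (H1&H2&H3); now apply is_derive_Vfun_ctrl. }
  destruct (Rle_dec t0 t) as [Hle|Hlt].
  - apply Rle_trans with (2 := H0).
    apply (nonincreasing_of_derive_nonpos (fun s => Vfun mu k1 k2 L0 A0 (x s) (v s))
             (fun u => - gradsq mu k1 k2 L0 A0 (x u) (v u))); [exact Hle| |].
    + intros u Hu; apply Hd; lra.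
    + intros u _; pose proof (gradsq_nonneg mu k1 k2 L0 A0 (x u) (v u)); lra.
  (* Monotonicity of [V] says nothing about earlier times. On the compact interval from [t] to [t0]
     the quantities [|x|], [|v|], [1/|x|] are bounded, which supplies a Gronwall constant. *)
  - assert (Hle : t <= t0) by lra.
    assert (Cx : forall u, a < u < b -> vlim (locally u) x (x u)).
    { intros u Hu; destruct (Hs u Hu) as (_&H2&_); apply (has_deriv3_vlim _ _ _ H2). }
    assert (Cv : forall u, a < u < b -> vlim (locally u) v (v u)).
    { intros u Hu; destruct (Hs u Hu) as (_&_&H2); apply (has_deriv3_vlim _ _ _ H2). }
    destruct (continuous_bounded_above (fun u => vnorm (x u)) t t0 Hle) as [B1 HB1].
    { intros u Hu; apply rlim_vnorm; [typeclasses eauto|apply Cx; lra]. }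
    destruct (continuous_bounded_above (fun u => vnorm (v u)) t t0 Hle) as [B2 HB2].
    { intros u Hu; apply rlim_vnorm; [typeclasses eauto|apply Cv; lra]. }
    destruct (continuous_bounded_above (fun u => invnorm (x u)) t t0 Hle) as [B3 HB3].
    { intros u Hu; apply rlim_invnorm; [typeclasses eauto|apply Cx; lra|apply Hx; lra]. }
    set (B := Rmax B1 (Rmax B2 B3)).
    destruct (gradsq_le_Vfun mu k1 k2 B L0 A0 Hmu Hk1 Hk2) as [C [HC Hg]].
    apply (zero_backward (fun s => Vfun mu k1 k2 L0 A0 (x s) (v s))
             (fun u => - gradsq mu k1 k2 L0 A0 (x u) (v u)) C t t0 Hle); [| |exact H0].
    + intros u Hu; apply Hd; lra.
    + intros u Hu; cbv beta.
      assert (K : gradsq mu k1 k2 L0 A0 (x u) (v u) <= C * Vfun mu k1 k2 L0 A0 (x u) (v u)).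
      { apply Hg; [apply Hx; lra|..].
        - apply Rle_trans with (1 := HB1 u Hu), Rmax_l.
        - apply Rle_trans with (1 := HB2 u Hu), Rle_trans with (2 := Rmax_r _ _), Rmax_l.
        - apply Rle_trans with (1 := HB3 u Hu), Rle_trans with (2 := Rmax_r _ _), Rmax_r. }
      lra.
Qed.

Lemma zero_set_invariant_kep (mu a b t0 : R) (L0 A0 : vec3) (x v : R -> vec3) :
  is_sol_on (kep_xdot mu) (kep_vdot mu) a b x v ->
  a < t0 < b -> in_zero_set mu L0 A0 (x t0) (v t0) ->
  forall t, a < t < b -> in_zero_set mu L0 A0 (x t) (v t).
Proof.
  intros Hs Ht0 H0 t Ht.
  assert (Hx : forall u, a < u < b -> x u <> vzero) by (intros; now apply Hs).
  (* Kepler's system has no gains; with unit weights [V] serves only to detect the zero set. *)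
  apply (Vfun_eq_0 mu 1 1 L0 A0) in H0; auto; try lra.
  apply (Vfun_eq_0 mu 1 1 L0 A0); auto; try lra.
  assert (Hd : forall u, a < u < b ->
    is_derive (fun s => Vfun mu 1 1 L0 A0 (x s) (v s)) u 0).
  { intros u Hu; destruct (Hs u Hu) as (H1&H2&H3); now apply is_derive_Vfun_kep. }
  destruct (Rle_dec t0 t) as [Hle|Hlt].
  - apply Rle_trans with (2 := H0).
    apply (nonincreasing_of_derive_nonpos (fun s => Vfun mu 1 1 L0 A0 (x s) (v s))
             (fun u => 0)); intros; try apply Hd; lra.
  - apply (zero_backward (fun s => Vfun mu 1 1 L0 A0 (x s) (v s))
             (fun u => 0) 0 t t0); intros; try apply Hd; lra.
Qed.

(** * Picard's theorem for bounded Lipschitz fields *)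

Lemma Rmax0_lipschitz (s t : R) : Rabs (Rmax 0 s - Rmax 0 t) <= Rabs (s - t).
Proof. unfold Rmax, Rabs; repeat destruct Rle_dec; repeat destruct Rcase_abs; lra. Qed.

Lemma eq0_of_geometric_bound (a D : R) : (forall n, Rabs a <= D * (1 / 2) ^ n) -> a = 0.
Proof.
  intro H; apply Rabs_eq_0, Rle_antisym; [|apply Rabs_pos].
  refine (is_lim_seq_le (fun _ => Rabs a) (fun n => D * (1 / 2) ^ n) (Rabs a) 0 H _ _).
  - apply is_lim_seq_const.
  - replace (Finite 0) with (Rbar_mult D 0) by (simpl; now rewrite Rmult_0_r).
    apply is_lim_seq_scal_l, is_lim_seq_geom; rewrite Rabs_pos_eq; lra.
Qed.

(* States are functions [J -> R]; a sup-norm bound [d] is written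
   [forall i, Rabs (u i - w i) <= d]. *)
Section Picard.
Variables (J : Type) (F : (J -> R) -> J -> R) (M K : R) (xi : J -> R).
Hypotheses (HM : 0 <= M) (HK : 0 < K).
Hypothesis F_bounded : forall u i, Rabs (F u i) <= M.
Hypothesis F_lipschitz : forall u w d,
  (forall i, Rabs (u i - w i) <= d) -> forall i, Rabs (F u i - F w i) <= K * d.

(** This property passes through a Picard step and through pointwise limits, and it makes the
    integrand [F (u s) i] continuous, hence integrable. *)
Definition time_lipschitz (u : R -> J -> R) : Prop :=
  forall s t i, Rabs (u s i - u t i) <= M * Rabs (s - t).

(** [Rmax 0 t] freezes the curve at [xi] for negative times, so curves are Lipschitz on the whole
    line. *)
Definition picard_step (u : R -> J -> R) (t : R) (i : J) : R :=
  xi i + RInt (fun s => F (u s) i) 0 (Rmax 0 t).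

Fixpoint picard (n : nat) : R -> J -> R :=
  match n with O => fun _ => xi | S m => picard_step (picard m) end.

Lemma field_along_continuous u i t :
  time_lipschitz u -> continuous (fun s => F (u s) i) t.
Proof.
  intro Hu; apply filterlim_locally; intros eps.
  assert (Hp : 0 < eps / (K * M + 1)) by (apply Rdiv_lt_0_compat; [apply cond_pos|nra]).
  exists (mkposreal _ Hp); intros s Hs.
  change (Rabs (s - t) < eps / (K * M + 1)) in Hs.
  change (Rabs (F (u s) i - F (u t) i) < eps).
  apply Rle_lt_trans with (K * (M * Rabs (s - t))).
  - apply F_lipschitz; intro j; apply Hu.
  - apply Rmult_lt_compat_r with (r := K * M + 1) in Hs; [|nra].
    unfold Rdiv in Hs; rewrite Rmult_assoc, Rinv_l, Rmult_1_r in Hs by nra.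
    pose proof (Rabs_pos (s - t)); nra.
Qed.

Lemma field_along_integrable u i a b :
  time_lipschitz u -> ex_RInt (fun s => F (u s) i) a b.
Proof.
  intro Hu; apply (ex_RInt_continuous (V := R_CompleteNormedModule)); intros.
  now apply field_along_continuous.
Qed.

Lemma picard_step_lipschitz u : time_lipschitz u -> time_lipschitz (picard_step u).
Proof.
  intro Hu.
  assert (P : forall s t i, s <= t ->
    Rabs (picard_step u t i - picard_step u s i) <= M * Rabs (t - s)).
  { intros s t i Hst; unfold picard_step.
    assert (Hm : Rmax 0 s <= Rmax 0 t) by (apply Rle_max_compat_l; exact Hst).
    rewrite <- (RInt_Chasles (fun s => F (u s) i) 0 (Rmax 0 s) (Rmax 0 t));
      try now apply field_along_integrable.
    unfold plus; simpl.
    assert (E : forall p q r : R, p + (q + r) - (p + q) = r) by (intros; ring).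
    rewrite E.
    apply Rle_trans with ((Rmax 0 t - Rmax 0 s) * M).
    - apply abs_RInt_le_const; auto; now apply field_along_integrable.
    - rewrite Rmult_comm; apply Rmult_le_compat_l; auto.
      apply Rle_trans with (2 := Rmax0_lipschitz t s), Rle_abs. }
  intros s t i; destruct (Rle_dec s t).
  - rewrite Rabs_minus_sym, (Rabs_minus_sym s); now apply P.
  - apply P; lra.
Qed.

Lemma picard_lipschitz n : time_lipschitz (picard n).
Proof.
  induction n; [|now apply picard_step_lipschitz].
  intros s t i; simpl; rewrite Rminus_diag, Rabs_R0.
  pose proof (Rabs_pos (s - t)); nra.
Qed.

(* In the weighted norm [sup_t exp(-2Kt) |u t|] the Picard operator contracts by [1/2]. *)
Lemma picard_step_contracts u w C :
  time_lipschitz u -> time_lipschitz w ->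
  (forall t i, 0 <= t -> Rabs (u t i - w t i) <= C * exp (2 * K * t)) ->
  forall t i, 0 <= t ->
    Rabs (picard_step u t i - picard_step w t i) <= C / 2 * exp (2 * K * t).
Proof.
  intros Hu Hw H t i Ht; unfold picard_step; rewrite Rmax_right by exact Ht.
  assert (HC : 0 <= C).
  { specialize (H 0 i (Rle_refl 0)); rewrite Rmult_0_r, exp_0 in H.
    pose proof (Rabs_pos (u 0 i - w 0 i)); lra. }
  set (fu := fun s => F (u s) i); set (fw := fun s => F (w s) i).
  replace (xi i + RInt fu 0 t - (xi i + RInt fw 0 t))
    with (RInt (fun s => minus (fu s) (fw s)) 0 t).
  2: { etransitivity.
       - apply (RInt_minus (V := R_CompleteNormedModule) fu fw 0 t);
           now apply field_along_integrable.
       - assert (E : forall p q r : R, q + - r = p + q - (p + r)) by (intros; ring).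
         apply E. }
  (* The integral of [K * (C * exp (2 * K * s))]; the 2 in the exponent is what yields the
     contraction factor [1/2]. *)
  apply Rle_trans with (C / 2 * exp (2 * K * t) - C / 2 * exp (2 * K * 0)).
  2: { rewrite Rmult_0_r, exp_0; lra. }
  refine (norm_RInt_le (fun s => minus (fu s) (fw s)) (fun s => K * (C * exp (2 * K * s)))
            0 t _ _ Ht _ _ _).
  - intros s Hs; apply F_lipschitz; intro j; apply H; lra.
  - apply (RInt_correct (V := R_CompleteNormedModule)).
    apply (ex_RInt_minus (V := R_NormedModule)); now apply field_along_integrable.
  - apply (is_RInt_derive (V := R_CompleteNormedModule) (fun s => C / 2 * exp (2 * K * s))).
    + intros s _; auto_derive; [exact I|field].
    + intros s _; apply (ex_derive_continuous (V := R_NormedModule)); auto_derive; exact I.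
Qed.

Lemma picard_increment n t i : 0 <= t ->
  Rabs (picard (S n) t i - picard n t i) <= M / K * (1 / 2) ^ n * exp (2 * K * t).
Proof.
  revert t i; induction n; intros t i Ht.
  - simpl; unfold picard_step; rewrite Rmax_right by exact Ht.
    rewrite Rplus_minus_l.
    (* The first increment is at most [M * t], and [K * t <= 1 + 2 * K * t <= exp (2 * K * t)]. *)
    apply Rle_trans with ((t - 0) * M).
    + apply abs_RInt_le_const; [exact Ht|apply ex_RInt_const|intros; apply F_bounded].
    + pose proof (exp_ineq1_le (2 * K * t)) as He.
      replace ((t - 0) * M) with (M / K * (K * t)) by (field; lra).
      rewrite Rmult_1_r; apply Rmult_le_compat_l; [|nra].
      apply Rdiv_le_0_compat; lra.
  - replace (M / K * (1 / 2) ^ S n) with (M / K * (1 / 2) ^ n / 2) by (simpl; field; lra).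
    apply (picard_step_contracts (picard (S n)) (picard n));
      auto using picard_lipschitz.
Qed.

(** Keeping the negative term [(1 / 2) ^ (n + k)] makes the geometric sum close under induction on
    [k]; [picard_tail] then drops it. *)
Lemma picard_cauchy n k t i : 0 <= t ->
  Rabs (picard (n + k) t i - picard n t i)
  <= 2 * (M / K) * ((1 / 2) ^ n - (1 / 2) ^ (n + k)) * exp (2 * K * t).
Proof.
  intro Ht; induction k.
  - rewrite Nat.add_0_r, !Rminus_diag, Rabs_R0; lra.
  - rewrite Nat.add_succ_r.
    pose proof (picard_increment (n + k) t i Ht).
    replace (picard (S (n + k)) t i - picard n t i)
      with ((picard (S (n + k)) t i - picard (n + k) t i)
            + (picard (n + k) t i - picard n t i)) by ring.
    apply Rle_trans with (1 := Rabs_triang _ _); simpl ((1 / 2) ^ S _); lra.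
Qed.

Lemma picard_tail n k t i : 0 <= t ->
  Rabs (picard (n + k) t i - picard n t i)
  <= 2 * (M / K) * exp (2 * K * t) * (1 / 2) ^ n.
Proof.
  intro Ht; apply Rle_trans with (1 := picard_cauchy n k t i Ht).
  assert (0 <= M / K) by (apply Rdiv_le_0_compat; lra).
  assert (0 < (1 / 2) ^ (n + k)) by (apply pow_lt; lra).
  pose proof (exp_pos (2 * K * t)).
  assert (0 <= M / K * exp (2 * K * t)) by nra.
  nra.
Qed.

(** [Lim_seq] is total, so the definition precedes convergence; [Rmax 0 t] extends the limit by a
    constant to negative times. *)
Definition picard_limit (t : R) (i : J) : R :=
  real (Lim_seq (fun n => picard n (Rmax 0 t) i)).

Lemma picard_limit_correct t i : 0 <= t ->
  is_lim_seq (fun n => picard n t i) (picard_limit t i).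
Proof.
  intro Ht; unfold picard_limit; rewrite Rmax_right by exact Ht.
  apply Lim_seq_correct', ex_lim_seq_cauchy_corr; intros eps.
  set (D := 2 * (M / K) * exp (2 * K * t)).
  assert (HD : is_lim_seq (fun n => D * (1 / 2) ^ n) 0).
  { replace (Finite 0) with (Rbar_mult D 0) by (simpl; now rewrite Rmult_0_r).
    apply is_lim_seq_scal_l, is_lim_seq_geom; rewrite Rabs_pos_eq; lra. }
  apply is_lim_seq_spec in HD; destruct (HD (pos_div_2 eps)) as [N HN].
  specialize (HN N (Nat.le_refl N)); rewrite Rminus_0_r in HN; simpl in HN.
  assert (HN' : D * (1 / 2) ^ N < eps / 2) by (pose proof (Rle_abs (D * (1 / 2) ^ N)); lra).
  exists N; intros n m Hn Hm.
  pose proof (picard_tail N (n - N) t i Ht) as H1.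
  pose proof (picard_tail N (m - N) t i Ht) as H2.
  rewrite Nat.add_comm, Nat.sub_add in H1, H2 by assumption; fold D in H1, H2.
  replace (picard n t i - picard m t i)
    with ((picard n t i - picard N t i) - (picard m t i - picard N t i)) by ring.
  apply Rle_lt_trans with (1 := Rabs_triang _ _); rewrite Rabs_Ropp; lra.
Qed.

Lemma picard_limit_rate n t i : 0 <= t ->
  Rabs (picard_limit t i - picard n t i) <= 2 * (M / K) * exp (2 * K * t) * (1 / 2) ^ n.
Proof.
  intro Ht.
  refine (is_lim_seq_le (fun k => Rabs (picard (k + n) t i - picard n t i)) (fun _ => _)
            (Rabs (picard_limit t i - picard n t i)) _ _ _ (is_lim_seq_const _)).
  - intro k; rewrite Nat.add_comm; now apply picard_tail.
  - apply (is_lim_seq_abs _ (Finite (picard_limit t i - picard n t i))).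
    apply is_lim_seq_minus'; [|apply is_lim_seq_const].
    apply (is_lim_seq_incr_n (fun k => picard k t i) n (picard_limit t i)).
    now apply picard_limit_correct.
Qed.

Lemma picard_limit_lipschitz : time_lipschitz picard_limit.
Proof.
  intros s t i.
  assert (E : forall r, picard_limit r i = picard_limit (Rmax 0 r) i).
  { intro r; unfold picard_limit; now rewrite (Rmax_right 0 (Rmax 0 r)) by apply Rmax_l. }
  rewrite (E s), (E t).
  apply Rle_trans with (M * Rabs (Rmax 0 s - Rmax 0 t));
    [|apply Rmult_le_compat_l; auto using Rmax0_lipschitz].
  refine (is_lim_seq_le
    (fun n => Rabs (picard n (Rmax 0 s) i - picard n (Rmax 0 t) i)) (fun _ => _)
    (Rabs (picard_limit (Rmax 0 s) i - picard_limit (Rmax 0 t) i)) _ _ _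
    (is_lim_seq_const _)).
  - intro n; apply picard_lipschitz.
  - apply (is_lim_seq_abs _
      (Finite (picard_limit (Rmax 0 s) i - picard_limit (Rmax 0 t) i))).
    apply is_lim_seq_minus'; apply picard_limit_correct, Rmax_l.
Qed.

(** Both sides lie within a multiple of [(1 / 2) ^ n] of the iterate [picard (S n)], the right side
    by contraction; this replaces a limit under the integral. *)
Lemma picard_limit_fixed t i : 0 <= t -> picard_limit t i = picard_step picard_limit t i.
Proof.
  intro Ht; apply Rminus_diag_uniq.
  apply eq0_of_geometric_bound with (D := 2 * (2 * (M / K) * exp (2 * K * t))); intro n.
  pose proof (picard_limit_rate (S n) t i Ht) as H1.
  assert (H2 : Rabs (picard_step (picard n) t i - picard_step picard_limit t i)
               <= 2 * (M / K) * (1 / 2) ^ n / 2 * exp (2 * K * t)).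
  { apply picard_step_contracts; auto using picard_lipschitz, picard_limit_lipschitz.
    intros s j Hs; rewrite Rabs_minus_sym.
    apply Rle_trans with (1 := picard_limit_rate n s j Hs); right; ring. }
  change (picard_step (picard n)) with (picard (S n)) in H2.
  replace (picard_limit t i - picard_step picard_limit t i)
    with ((picard_limit t i - picard (S n) t i)
          + (picard (S n) t i - picard_step picard_limit t i)) by ring.
  apply Rle_trans with (1 := Rabs_triang _ _).
  simpl ((1 / 2) ^ S n) in H1.
  assert (0 <= M / K * exp (2 * K * t) * (1 / 2) ^ n).
  { repeat apply Rmult_le_pos; [exact HM|left; now apply Rinv_0_lt_compat
      |left; apply exp_pos|apply pow_le; lra]. }
  lra.
Qed.

(** The curve is constant for negative times and may have a corner at 0, hence the equation for
    [0 < t] only, as in [is_fwd_sol]. *)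
Theorem picard_lindelof : exists u : R -> J -> R,
  (forall i, u 0 i = xi i) /\ time_lipschitz u /\
  forall t i, 0 < t -> is_derive (fun s => u s i) t (F (u t) i).
Proof.
  exists picard_limit; split; [|split].
  - intro i; rewrite picard_limit_fixed by lra; unfold picard_step.
    rewrite Rmax_left by lra; rewrite RInt_point; unfold zero; simpl; ring.
  - apply picard_limit_lipschitz.
  - intros t i Ht.
    assert (Hpos : locally t (fun s => 0 < s)) by now apply (open_gt 0).
    apply is_derive_ext_loc with
      (f := fun s => plus (xi i) (RInt (fun r => F (picard_limit r) i) 0 s)).
    + apply filter_imp with (2 := Hpos); intros s Hs.
      rewrite (picard_limit_fixed s) by lra; unfold picard_step.
      now rewrite Rmax_right by lra.
    + replace (F (picard_limit t) i) with (plus zero (F (picard_limit t) i))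
        by apply plus_zero_l.
      apply (is_derive_plus (V := R_NormedModule));
        [apply (is_derive_const (V := R_NormedModule))|].
      apply (is_derive_RInt (V := R_NormedModule) (fun r => F (picard_limit r) i)
               (fun s => RInt (fun r => F (picard_limit r) i) 0 s) 0 t).
      * apply filter_forall; intro s.
        apply (RInt_correct (V := R_CompleteNormedModule)), field_along_integrable,
          picard_limit_lipschitz.
      * apply field_along_continuous, picard_limit_lipschitz.
Qed.
End Picard.

(** * Global existence *)

Section BoundedLipschitz.
Context {J : Type}.
Implicit Types (g h : (J -> R) -> R) (f : (J -> R) -> vec3).

(** Boundedness is carried along so that the class is closed under products; it then contains every
    polynomial in the clamped coordinates and the cut-off [1/|x|]. *)
Definition bounded_lipschitz g : Prop :=
  exists B K, 0 <= B /\ 0 <= K /\ (forall u, Rabs (g u) <= B) /\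
    forall u w d, (forall i, Rabs (u i - w i) <= d) -> Rabs (g u - g w) <= K * d.

Definition bounded_lipschitz3 f : Prop :=
  bounded_lipschitz (fun u => vx (f u)) /\ bounded_lipschitz (fun u => vy (f u)) /\
  bounded_lipschitz (fun u => vz (f u)).

Lemma bounded_lipschitz_const (c : R) : bounded_lipschitz (fun _ => c).
Proof.
  exists (Rabs c), 0; split; [apply Rabs_pos|split; [lra|split; [intro; lra|]]].
  intros; rewrite Rminus_diag, Rabs_R0; lra.
Qed.

Lemma bounded_lipschitz_plus g h :
  bounded_lipschitz g -> bounded_lipschitz h -> bounded_lipschitz (fun u => g u + h u).
Proof.
  intros (B1&K1&?&?&P1&Q1) (B2&K2&?&?&P2&Q2); exists (B1 + B2), (K1 + K2).
  split; [lra|split; [lra|split]].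
  - intro u; apply Rle_trans with (1 := Rabs_triang _ _).
    specialize (P1 u); specialize (P2 u); lra.
  - intros u w d Hd.
    replace (g u + h u - (g w + h w)) with ((g u - g w) + (h u - h w)) by ring.
    apply Rle_trans with (1 := Rabs_triang _ _).
    specialize (Q1 u w d Hd); specialize (Q2 u w d Hd); lra.
Qed.

Lemma bounded_lipschitz_mult g h :
  bounded_lipschitz g -> bounded_lipschitz h -> bounded_lipschitz (fun u => g u * h u).
Proof.
  intros (B1&K1&?&?&P1&Q1) (B2&K2&?&?&P2&Q2); exists (B1 * B2), (B1 * K2 + K1 * B2).
  split; [nra|split; [nra|split]].
  - intro u; rewrite Rabs_mult; apply Rmult_le_compat; auto using Rabs_pos.
  - intros u w d Hd.
    replace (g u * h u - g w * h w) with (g u * (h u - h w) + (g u - g w) * h w) by ring.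
    apply Rle_trans with (1 := Rabs_triang _ _); rewrite !Rabs_mult.
    specialize (Q1 u w d Hd); specialize (Q2 u w d Hd).
    assert (Rabs (g u) * Rabs (h u - h w) <= B1 * (K2 * d))
      by (apply Rmult_le_compat; auto using Rabs_pos).
    assert (Rabs (g u - g w) * Rabs (h w) <= K1 * d * B2)
      by (apply Rmult_le_compat; auto using Rabs_pos).
    lra.
Qed.

Lemma bounded_lipschitz_minus g h :
  bounded_lipschitz g -> bounded_lipschitz h -> bounded_lipschitz (fun u => g u - h u).
Proof.
  intros Hg (B2&K2&?&?&P2&Q2); apply bounded_lipschitz_plus; [exact Hg|].
  exists B2, K2; repeat split; auto.
  - intro; rewrite Rabs_Ropp; auto.
  - intros u w d Hd; replace (- h u - - h w) with (- (h u - h w)) by ring.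
    rewrite Rabs_Ropp; auto.
Qed.

Definition clamp (M s : R) : R := Rmax (- M) (Rmin M s).

Lemma clamp_id M s : Rabs s <= M -> clamp M s = s.
Proof. intro H; apply Rabs_le_between in H; unfold clamp; rewrite Rmin_right, Rmax_right; lra. Qed.

Lemma bounded_lipschitz_clamp M i : 0 <= M -> bounded_lipschitz (fun u => clamp M (u i)).
Proof.
  intro HM; exists M, 1; split; [lra|split; [lra|split]].
  - intro u; unfold clamp, Rmax, Rmin, Rabs.
    repeat destruct Rle_dec; repeat destruct Rcase_abs; lra.
  - intros u w d Hd; rewrite Rmult_1_l; apply Rle_trans with (2 := Hd i).
    unfold clamp, Rmax, Rmin, Rabs.
    repeat destruct Rle_dec; repeat destruct Rcase_abs; lra.
Qed.

(** For the two roots [a, b >= q], [1/a - 1/b = (b^2 - a^2) / (a b (a + b))]: the numerator involves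
    only the squares, and the denominator is at least [q^3]. *)
Lemma bounded_lipschitz_inv_sqrt (q : R) g : 0 < q ->
  bounded_lipschitz g -> bounded_lipschitz (fun u => / sqrt (Rmax (q ^ 2) (g u))).
Proof.
  intros Hq (B&K&HB&HK&P&Q).
  assert (Hs : forall s, q <= sqrt (Rmax (q ^ 2) s)).
  { intro s; rewrite <- (sqrt_pow2 q) at 1 by lra; apply sqrt_le_1_alt, Rmax_l. }
  assert (H3 : 0 < q ^ 3) by now apply pow_lt.
  exists (/ q), (/ q ^ 3 * K); split; [left; now apply Rinv_0_lt_compat|split; [|split]].
  - apply Rmult_le_pos; [left; now apply Rinv_0_lt_compat|exact HK].
  - intro u; specialize (Hs (g u)); rewrite Rabs_pos_eq.
    + now apply Rinv_le_contravar.
    + left; apply Rinv_0_lt_compat; lra.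
  - intros u w d Hd; rewrite Rmult_assoc.
    apply Rle_trans with (/ q ^ 3 * Rabs (g u - g w)).
    2: { apply Rmult_le_compat_l; [left; now apply Rinv_0_lt_compat|auto]. }
    pose proof (Hs (g u)) as Ha; pose proof (Hs (g w)) as Hb.
    apply Rle_trans with (/ q ^ 3 * Rabs (Rmax (q ^ 2) (g w) - Rmax (q ^ 2) (g u))).
    2: { apply Rmult_le_compat_l; [left; now apply Rinv_0_lt_compat|].
         unfold Rmax, Rabs; repeat destruct Rle_dec; repeat destruct Rcase_abs; lra. }
    assert (Hq2 : 0 <= q ^ 2) by nra.
    assert (Ea : sqrt (Rmax (q ^ 2) (g u)) ^ 2 = Rmax (q ^ 2) (g u))
      by (apply pow2_sqrt, Rle_trans with (2 := Rmax_l _ _); exact Hq2).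
    assert (Eb : sqrt (Rmax (q ^ 2) (g w)) ^ 2 = Rmax (q ^ 2) (g w))
      by (apply pow2_sqrt, Rle_trans with (2 := Rmax_l _ _); exact Hq2).
    revert Ha Hb Ea Eb.
    generalize (sqrt (Rmax (q ^ 2) (g u))) (sqrt (Rmax (q ^ 2) (g w))).
    intros a b Ha Hb <- <-.
    replace (/ a - / b) with (/ (a * b * (a + b)) * (b ^ 2 - a ^ 2)) by (field; lra).
    assert (Hab : q ^ 3 <= a * b * (a + b)).
    { assert (q * q <= a * b) by (apply Rmult_le_compat; lra).
      replace (q ^ 3) with (q * q * q) by ring; apply Rmult_le_compat; nra. }
    rewrite Rabs_mult, Rabs_pos_eq by (left; apply Rinv_0_lt_compat; lra).
    apply Rmult_le_compat_r; [apply Rabs_pos|]; now apply Rinv_le_contravar.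
Qed.

Lemma bounded_lipschitz3_const a : bounded_lipschitz3 (fun _ => a).
Proof. split; [|split]; apply bounded_lipschitz_const. Qed.

Lemma bounded_lipschitz3_add f1 f2 : bounded_lipschitz3 f1 -> bounded_lipschitz3 f2 ->
  bounded_lipschitz3 (fun u => vadd (f1 u) (f2 u)).
Proof. intros (?&?&?) (?&?&?); split; [|split]; now apply bounded_lipschitz_plus. Qed.

Lemma bounded_lipschitz3_sub f1 f2 : bounded_lipschitz3 f1 -> bounded_lipschitz3 f2 ->
  bounded_lipschitz3 (fun u => vsub (f1 u) (f2 u)).
Proof. intros (?&?&?) (?&?&?); split; [|split]; now apply bounded_lipschitz_minus. Qed.

Lemma bounded_lipschitz3_scale g f : bounded_lipschitz g -> bounded_lipschitz3 f ->
  bounded_lipschitz3 (fun u => vscale (g u) (f u)).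
Proof. intros ? (?&?&?); split; [|split]; now apply bounded_lipschitz_mult. Qed.

Lemma bounded_lipschitz3_cross f1 f2 : bounded_lipschitz3 f1 -> bounded_lipschitz3 f2 ->
  bounded_lipschitz3 (fun u => cross (f1 u) (f2 u)).
Proof.
  intros (?&?&?) (?&?&?); split; [|split];
    apply bounded_lipschitz_minus; now apply bounded_lipschitz_mult.
Qed.

Lemma bounded_lipschitz_dot f1 f2 : bounded_lipschitz3 f1 -> bounded_lipschitz3 f2 ->
  bounded_lipschitz (fun u => dot (f1 u) (f2 u)).
Proof.
  intros (?&?&?) (?&?&?); repeat apply bounded_lipschitz_plus;
    now apply bounded_lipschitz_mult.
Qed.
End BoundedLipschitz.

(** Index type presenting phase space as functions, the form of state used by the Picard section. *)
Inductive coord := X1 | X2 | X3 | V1 | V2 | V3.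

Definition position (u : coord -> R) : vec3 := mkV (u X1) (u X2) (u X3).
Definition velocity (u : coord -> R) : vec3 := mkV (u V1) (u V2) (u V3).

Definition state (x v : vec3) (i : coord) : R :=
  match i with
  | X1 => vx x | X2 => vy x | X3 => vz x | V1 => vx v | V2 => vy v | V3 => vz v
  end.

Definition clamp3 (M : R) (a : vec3) : vec3 :=
  mkV (clamp M (vx a)) (clamp M (vy a)) (clamp M (vz a)).

Definition invnorm_trunc (q : R) (x : vec3) : R := / sqrt (Rmax (q ^ 2) (dot x x)).

Lemma clamp3_id M a : vnorm a <= M -> clamp3 M a = a.
Proof.
  intro H; pose proof (Rabs_coord_le_vnorm a) as (?&?&?); destruct a; unfold clamp3; cbn in *.
  f_equal; apply clamp_id; lra.
Qed.

Lemma invnorm_trunc_id q x : 0 < q -> q <= vnorm x -> invnorm_trunc q x = invnorm x.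
Proof.
  intros Hq H; unfold invnorm_trunc, invnorm; f_equal; unfold vnorm; f_equal.
  apply Rmax_right; rewrite <- vnorm_sq; apply pow_incr; lra.
Qed.

(* Control system with [x], [v] and [1/|x|] cut off: globally Lipschitz, and equal
   to the original one where [q <= |x| <= M] and [|v| <= M]. *)
Section Truncation.
Variables (mu k1 k2 q M : R) (L0 A0 : vec3).

Definition trunc_xdot (x v : vec3) : vec3 :=
  let x := clamp3 M x in let v := clamp3 M v in let w := invnorm_trunc q x in
  vsub v (adjx mu w x v (vscale k1 (vsub (cross x v) L0)) (vscale k2 (vsub (lrl mu w x v) A0))).
Definition trunc_vdot (x v : vec3) : vec3 :=
  let x := clamp3 M x in let v := clamp3 M v in let w := invnorm_trunc q x in
  vsub (vscale (- mu * w ^ 3) x)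
    (adjv x v (vscale k1 (vsub (cross x v) L0)) (vscale k2 (vsub (lrl mu w x v) A0))).
Definition trunc_field (u : coord -> R) : coord -> R :=
  state (trunc_xdot (position u) (velocity u)) (trunc_vdot (position u) (velocity u)).

Lemma trunc_eq_ctrl x v : 0 < q -> q <= vnorm x -> vnorm x <= M -> vnorm v <= M ->
  trunc_xdot x v = ctrl_xdot mu k1 k2 L0 A0 x v /\
  trunc_vdot x v = ctrl_vdot mu k1 k2 L0 A0 x v.
Proof.
  intros Hq Hx1 Hx2 Hv; rewrite ctrl_xdot_grad, ctrl_vdot_grad.
  unfold trunc_xdot, trunc_vdot; cbv zeta.
  now rewrite (clamp3_id M x Hx2), (clamp3_id M v Hv), (invnorm_trunc_id q x Hq Hx1).
Qed.

Lemma trunc_field_bounded_lipschitz : 0 < q -> 0 <= M ->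
  forall i, bounded_lipschitz (fun u => trunc_field u i).
Proof.
  intros Hq HM.
  assert (Hx : bounded_lipschitz3 (fun u => clamp3 M (position u)))
    by (split; [|split]; cbn; now apply bounded_lipschitz_clamp).
  assert (Hv : bounded_lipschitz3 (fun u => clamp3 M (velocity u)))
    by (split; [|split]; cbn; now apply bounded_lipschitz_clamp).
  assert (Hw : bounded_lipschitz (fun u => invnorm_trunc q (clamp3 M (position u))))
    by (apply bounded_lipschitz_inv_sqrt; [exact Hq|now apply bounded_lipschitz_dot]).
  assert (Ha : bounded_lipschitz3 (fun u =>
    vscale k1 (vsub (cross (clamp3 M (position u)) (clamp3 M (velocity u))) L0))).
  { apply bounded_lipschitz3_scale; [apply bounded_lipschitz_const|].
    apply bounded_lipschitz3_sub; [|apply bounded_lipschitz3_const].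
    now apply bounded_lipschitz3_cross. }
  assert (Hb : bounded_lipschitz3 (fun u => vscale k2
    (vsub (lrl mu (invnorm_trunc q (clamp3 M (position u)))
             (clamp3 M (position u)) (clamp3 M (velocity u))) A0))).
  { apply bounded_lipschitz3_scale; [apply bounded_lipschitz_const|].
    apply bounded_lipschitz3_sub; [|apply bounded_lipschitz3_const].
    apply bounded_lipschitz3_sub.
    - apply bounded_lipschitz3_cross; [exact Hv|now apply bounded_lipschitz3_cross].
    - apply bounded_lipschitz3_scale; [|exact Hx].
      apply bounded_lipschitz_mult; [apply bounded_lipschitz_const|exact Hw]. }
  assert (Hmw : bounded_lipschitz (fun u => mu * invnorm_trunc q (clamp3 M (position u))))
    by (apply bounded_lipschitz_mult; [apply bounded_lipschitz_const|exact Hw]).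
  assert (Hw3 : bounded_lipschitz (fun u => invnorm_trunc q (clamp3 M (position u)) ^ 3))
    by (repeat (apply bounded_lipschitz_mult; [exact Hw|]); apply bounded_lipschitz_const).
  assert (HX : bounded_lipschitz3 (fun u => trunc_xdot (position u) (velocity u))).
  { unfold trunc_xdot, adjx; cbv zeta.
    apply bounded_lipschitz3_sub; [exact Hv|].
    apply bounded_lipschitz3_add; [now apply bounded_lipschitz3_cross|].
    apply bounded_lipschitz3_add.
    - apply bounded_lipschitz3_sub.
      + apply bounded_lipschitz3_cross; [exact Hv|now apply bounded_lipschitz3_cross].
      + now apply bounded_lipschitz3_scale.
    - apply bounded_lipschitz3_scale; [|exact Hx].
      apply bounded_lipschitz_mult; [|now apply bounded_lipschitz_dot].
      apply bounded_lipschitz_mult; [apply bounded_lipschitz_const|exact Hw3]. }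
  assert (HV : bounded_lipschitz3 (fun u => trunc_vdot (position u) (velocity u))).
  { unfold trunc_vdot, adjv; cbv zeta.
    apply bounded_lipschitz3_sub.
    - apply bounded_lipschitz3_scale; [|exact Hx].
      apply bounded_lipschitz_mult; [apply bounded_lipschitz_const|exact Hw3].
    - apply bounded_lipschitz3_add; [now apply bounded_lipschitz3_cross|].
      apply bounded_lipschitz3_add.
      + apply bounded_lipschitz3_cross; [now apply bounded_lipschitz3_cross|exact Hb].
      + apply bounded_lipschitz3_cross; [exact Hx|now apply bounded_lipschitz3_cross]. }
  destruct HX as (?&?&?), HV as (?&?&?); intros []; assumption.
Qed.

Lemma uniform_constants (F : (coord -> R) -> coord -> R) :
  (forall i, bounded_lipschitz (fun u => F u i)) ->
  exists B K, 0 <= B /\ 0 < K /\ (forall u i, Rabs (F u i) <= B) /\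
    forall u w d, (forall i, Rabs (u i - w i) <= d) ->
      forall i, Rabs (F u i - F w i) <= K * d.
Proof.
  intro H.
  destruct (H X1) as (B1&K1&?&?&P1&Q1), (H X2) as (B2&K2&?&?&P2&Q2),
    (H X3) as (B3&K3&?&?&P3&Q3), (H V1) as (B4&K4&?&?&P4&Q4),
    (H V2) as (B5&K5&?&?&P5&Q5), (H V3) as (B6&K6&?&?&P6&Q6).
  (* Sums stand in for maxima; the [+ 1] makes the Lipschitz constant positive, since the Picard
     estimates divide by it. *)
  exists (B1 + B2 + B3 + B4 + B5 + B6), (K1 + K2 + K3 + K4 + K5 + K6 + 1).
  split; [lra|split; [lra|split]].
  - intros u []; [specialize (P1 u)|specialize (P2 u)|specialize (P3 u)
      |specialize (P4 u)|specialize (P5 u)|specialize (P6 u)]; lra.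
  - intros u w d Hd.
    assert (Hd0 : 0 <= d) by (apply Rle_trans with (2 := Hd X1), Rabs_pos).
    intros []; [specialize (Q1 u w d Hd)|specialize (Q2 u w d Hd)|specialize (Q3 u w d Hd)
      |specialize (Q4 u w d Hd)|specialize (Q5 u w d Hd)|specialize (Q6 u w d Hd)]; nra.
Qed.
End Truncation.

Lemma vnorm_le_coords (a : vec3) (d : R) :
  Rabs (vx a) <= d -> Rabs (vy a) <= d -> Rabs (vz a) <= d -> vnorm a <= 3 * d.
Proof.
  intros H1 H2 H3; pose proof (Rabs_pos (vx a)).
  unfold vnorm; rewrite <- (sqrt_pow2 (3 * d)) by lra; apply sqrt_le_1_alt; unfold dot.
  apply Rabs_le_between in H1, H2, H3; nra.
Qed.

Section GlobalExistence.
Variables (mu k1 k2 c r M : R) (L0 A0 : vec3).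
Hypotheses (Hr : 0 < r) (HM : 0 < M).
Hypothesis sublevel_box : forall x v, in_sublevel mu k1 k2 L0 A0 c x v ->
  r <= vnorm x /\ vnorm x <= M /\ vnorm v <= M /\ Lmom x v <> vzero.

Lemma global_existence xi vi : in_sublevel mu k1 k2 L0 A0 c xi vi ->
  exists x v : R -> vec3, x 0 = xi /\ v 0 = vi /\
    is_fwd_sol (ctrl_xdot mu k1 k2 L0 A0) (ctrl_vdot mu k1 k2 L0 A0) None x v.
Proof.
  intro Hi.
  (* The cut-offs [r / 2] and [M + 1] leave a margin [Rmin (r / 2) 1] around the box that contains
     the sublevel set. *)
  destruct (uniform_constants _ (trunc_field_bounded_lipschitz mu k1 k2 (r / 2) (M + 1) L0 A0
    ltac:(lra) ltac:(lra))) as (B&K&HB&HK&Hbd&Hlip).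
  destruct (picard_lindelof coord _ B K (state xi vi) HB HK Hbd Hlip) as (u&Hu0&Hul&Hud).
  set (x := fun t => position (u t)); set (v := fun t => velocity (u t)).
  assert (Ex : x 0 = xi) by (unfold x, position; rewrite !Hu0; apply vec3_eta).
  assert (Ev : v 0 = vi) by (unfold v, velocity; rewrite !Hu0; apply vec3_eta).
  assert (Lx : forall s t, vnorm (vsub (x s) (x t)) <= 3 * (B * Rabs (s - t)))
    by (intros; apply vnorm_le_coords; apply Hul).
  assert (Lv : forall s t, vnorm (vsub (v s) (v t)) <= 3 * (B * Rabs (s - t)))
    by (intros; apply vnorm_le_coords; apply Hul).
  assert (Rc : forall f, (forall s t, vnorm (vsub (f s) (f t)) <= 3 * (B * Rabs (s - t))) ->
    rcont_at0 f).
  { intros f Hf eps Heps; exists (eps / (3 * B + 1)); split.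
    - apply Rdiv_lt_0_compat; lra.
    - intros t Ht; apply Rle_lt_trans with (1 := Hf t 0).
      rewrite Rminus_0_r, Rabs_pos_eq by lra.
      destruct Ht as [Ht0 Ht]; apply Rmult_lt_compat_r with (r := 3 * B + 1) in Ht; [|lra].
      unfold Rdiv in Ht; rewrite Rmult_assoc, Rinv_l in Ht by lra; lra. }
  assert (Dx : forall t, 0 < t -> has_deriv3 x t
    (trunc_xdot mu k1 k2 (r / 2) (M + 1) L0 A0 (x t) (v t))).
  { intros t Ht; split; [|split]; apply is_derive_Reals;
      [apply (Hud t X1 Ht)|apply (Hud t X2 Ht)|apply (Hud t X3 Ht)]. }
  assert (Dv : forall t, 0 < t -> has_deriv3 v t
    (trunc_vdot mu k1 k2 (r / 2) (M + 1) L0 A0 (x t) (v t))).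
  { intros t Ht; split; [|split]; apply is_derive_Reals;
      [apply (Hud t V1 Ht)|apply (Hud t V2 Ht)|apply (Hud t V3 Ht)]. }
  set (box := fun t => r / 2 <= vnorm (x t) /\ vnorm (x t) <= M + 1 /\ vnorm (v t) <= M + 1).
  (* Stated for every horizon [T]: the induction below needs monotonicity of [V] on a bounded
     interval before the curve is known to stay in the box forever. *)
  assert (Hsol : forall T, (forall t, 0 <= t -> before T t -> box t) ->
    is_fwd_sol (ctrl_xdot mu k1 k2 L0 A0) (ctrl_vdot mu k1 k2 L0 A0) T x v).
  { intros T HT; split; [|split; [now apply Rc|split; [now apply Rc|]]].
    - intros t Ht HtT; destruct (HT t) as (b1&b2&b3); [lra|exact HtT|].
      destruct (trunc_eq_ctrl mu k1 k2 (r / 2) (M + 1) L0 A0 (x t) (v t)) as [<- <-];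
        auto; lra.
    - intros t Ht HtT E; destruct (HT t Ht HtT) as (b1&_); rewrite E, vnorm_zero in b1; lra. }
  (* [x] and [v] move at speed at most [3 * B], so the margin is not exceeded within time [h]; the
     [+ 1] covers [B = 0]. *)
  set (h := Rmin (r / 2) 1 / (3 * B + 1)).
  assert (Hm : 0 < Rmin (r / 2) 1) by (apply Rmin_glb_lt; lra).
  assert (Hh : 0 < h) by (apply Rdiv_lt_0_compat; lra).
  assert (Hh3 : 3 * (B * h) <= Rmin (r / 2) 1).
  { assert (h * (3 * B + 1) = Rmin (r / 2) 1) by (unfold h; field; lra); lra. }
  pose proof (Rmin_l (r / 2) 1); pose proof (Rmin_r (r / 2) 1).
  (* Since the flow speed is bounded, leaving the sublevel set's box takes time at least
     [h]; monotonicity of [V] puts the solution back into the sublevel set. *)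
  assert (Hbox : forall n t, 0 <= t < INR n * h -> box t).
  { induction n; intros t Ht; [simpl in Ht; lra|].
    rewrite S_INR in Ht.
    assert (Hs : exists s, 0 <= s <= t /\ t - s <= h /\ in_sublevel mu k1 k2 L0 A0 c (x s) (v s)).
    { destruct (Rle_dec t h) as [Hth|Hth].
      - exists 0; rewrite Ex, Ev; repeat split; try lra; apply Hi.
      - exists (t - h); split; [lra|split; [lra|]].
        assert (S : is_fwd_sol (ctrl_xdot mu k1 k2 L0 A0) (ctrl_vdot mu k1 k2 L0 A0)
          (Some (INR n * h)) x v) by (apply Hsol; intros; apply IHn; simpl in *; lra).
        split; [apply S; simpl; lra|].
        apply Rle_trans with (Vfun mu k1 k2 L0 A0 (x 0) (v 0)).
        + apply (Vfun_antitone mu k1 k2 L0 A0 _ x v S); simpl; lra.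
        + rewrite Ex, Ev; apply Hi. }
    destruct Hs as (s&Hs1&Hs2&Hs3); apply sublevel_box in Hs3; destruct Hs3 as (b1&b2&b3&_).
    assert (Hd : 3 * (B * Rabs (t - s)) <= Rmin (r / 2) 1).
    { apply Rle_trans with (2 := Hh3); rewrite Rabs_pos_eq by lra.
      apply Rmult_le_compat_l; [lra|]; apply Rmult_le_compat_l; lra. }
    pose proof (Lx t s); pose proof (Lv t s).
    pose proof (vnorm_le_sub (x t) (x s)); pose proof (vnorm_le_sub (v t) (v s)).
    pose proof (vnorm_le_sub (x s) (x t)) as Hxs; rewrite vnorm_sub_comm in Hxs.
    unfold box; lra. }
  exists x, v; split; [exact Ex|split; [exact Ev|]].
  apply Hsol; intros t Ht _.
  destruct (INR_unbounded (t / h)) as [n Hn].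
  apply (Hbox n); split; [exact Ht|].
  apply Rmult_lt_compat_r with (r := h) in Hn; [|exact Hh].
  unfold Rdiv in Hn; rewrite Rmult_assoc, Rinv_l in Hn; lra.
Qed.
End GlobalExistence.

(** * Convergence *)

Lemma fun_choice {X Y : Type} (P : X -> Y -> Prop) :
  (forall x, exists y, P x y) -> exists f, forall x, P x (f x).
Proof.
  intro H; exists (fun x => proj1_sig (constructive_indefinite_description _ (H x))).
  intro x; apply proj2_sig.
Qed.

(** Subsequences are encoded by [n <= phi n], a condition that is stable under composition and
    preserves limits. *)
Lemma filterlim_ge_id (phi : nat -> nat) :
  (forall n, (n <= phi n)%nat) -> filterlim phi eventually eventually.
Proof.
  intros H P [N HN]; exists N; intros n Hn; apply HN, (Nat.le_trans _ n); auto.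
Qed.

Lemma is_lim_seq_inv_succ : is_lim_seq (fun n => / (INR n + 1)) 0.
Proof.
  change (is_lim_seq (fun n => / (INR n + 1)) (Rbar_inv p_infty)).
  apply is_lim_seq_inv; [|discriminate].
  eapply is_lim_seq_plus; [apply is_lim_seq_INR|apply is_lim_seq_const|reflexivity].
Qed.

Lemma bounded_subsequence (u : nat -> R) (B : R) : (forall n, Rabs (u n) <= B) ->
  exists phi, (forall n, (n <= phi n)%nat) /\
    exists l : R, is_lim_seq (fun n => u (phi n)) l.
Proof.
  intro H.
  destruct (Bolzano_Weierstrass u (fun s => - B <= s <= B) (compact_P3 (- B) B)) as [l Hl].
  { intro n; apply Rabs_le_between, H. }
  assert (K : forall n, exists p, (n <= p)%nat /\ Rabs (u p - l) < / (INR n + 1)).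
  { intro n; pose proof (pos_INR n) as Pn.
    assert (Hp : 0 < / (INR n + 1)) by (apply Rinv_0_lt_compat; lra).
    apply (Hl (disc l (mkposreal _ Hp)) n).
    exists (mkposreal _ Hp); intros s Hs; exact Hs. }
  apply fun_choice in K; destruct K as [phi Hphi].
  exists phi; split; [intro n; apply Hphi|]; exists l.
  apply is_lim_seq_spec; intros eps.
  pose proof is_lim_seq_inv_succ as Hinv.
  apply is_lim_seq_spec in Hinv; destruct (Hinv eps) as [N HN].
  exists N; intros n Hn; apply Rlt_trans with (1 := proj2 (Hphi n)).
  specialize (HN n Hn); rewrite Rminus_0_r in HN.
  apply Rle_lt_trans with (2 := HN), Rle_abs.
Qed.

Lemma bounded_subsequence_coords (u : nat -> coord -> R) (B : R) (ls : list coord) :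
  (forall n i, Rabs (u n i) <= B) ->
  exists phi, (forall n, (n <= phi n)%nat) /\
    forall i, In i ls -> exists l : R, is_lim_seq (fun n => u (phi n) i) l.
Proof.
  intro H; induction ls as [|a ls [phi [Hphi Hl]]].
  { exists (fun n => n); split; [auto|intros i []]. }
  destruct (bounded_subsequence (fun n => u (phi n) a) B) as [psi [Hpsi [la Hla]]]; auto.
  exists (fun n => phi (psi n)); split.
  { intro n; apply (Nat.le_trans _ (psi n)); auto. }
  intros i [<-|Hi]; [now exists la|].
  destruct (Hl i Hi) as [l Hl']; exists l.
  apply (is_lim_seq_subseq (fun n => u (phi n) i)); [now apply filterlim_ge_id|exact Hl'].
Qed.

(** * Compactness of the sublevel set and decay of [V] *)

Section Convergence.
Variables (mu k1 k2 c r M : R) (L0 A0 : vec3).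
Hypotheses (Hk1 : 0 < k1) (Hk2 : 0 < k2) (Hr : 0 < r).
Hypothesis L0_perp_A0 : dot L0 A0 = 0.
Hypothesis sublevel_box : forall x v, in_sublevel mu k1 k2 L0 A0 c x v ->
  r <= vnorm x /\ vnorm x <= M /\ vnorm v <= M /\ Lmom x v <> vzero.

Let V := Vfun mu k1 k2 L0 A0.

Lemma rlim_le (f g : nat -> R) (a b : R) :
  (forall n, f n <= g n) -> rlim eventually f a -> rlim eventually g b -> a <= b.
Proof. intros H Hf Hg; exact (is_lim_seq_le f g a b H Hf Hg). Qed.

Lemma sublevel_compact (x v : nat -> vec3) :
  (forall n, in_sublevel mu k1 k2 L0 A0 c (x n) (v n)) ->
  exists phi lx lv, (forall n, (n <= phi n)%nat) /\
    vlim eventually (fun n => x (phi n)) lx /\ vlim eventually (fun n => v (phi n)) lv /\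
    in_sublevel mu k1 k2 L0 A0 c lx lv.
Proof.
  intro H.
  destruct (bounded_subsequence_coords (fun n => state (x n) (v n)) M
    (X1 :: X2 :: X3 :: V1 :: V2 :: V3 :: nil)) as [phi [Hphi Hl]].
  { intros n; destruct (sublevel_box _ _ (H n)) as (_&H1&H2&_).
    pose proof (Rabs_coord_le_vnorm (x n)) as (?&?&?).
    pose proof (Rabs_coord_le_vnorm (v n)) as (?&?&?).
    intros []; simpl; lra. }
  destruct (Hl X1) as [l1 P1], (Hl X2) as [l2 P2], (Hl X3) as [l3 P3], (Hl V1) as [l4 P4],
    (Hl V2) as [l5 P5], (Hl V3) as [l6 P6]; simpl; auto 10.
  set (lx := mkV l1 l2 l3); set (lv := mkV l4 l5 l6).
  assert (Cx : vlim eventually (fun n => x (phi n)) lx) by (split; [|split]; assumption).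
  assert (Cv : vlim eventually (fun n => v (phi n)) lv) by (split; [|split]; assumption).
  exists phi, lx, lv; split; [exact Hphi|split; [exact Cx|split; [exact Cv|]]].
  assert (Hlx : lx <> vzero).
  { intro E.
    assert (r <= vnorm lx).
    { apply (rlim_le (fun _ => r) (fun n => vnorm (x (phi n)))).
      - intro n; apply (sublevel_box _ _ (H (phi n))).
      - apply rlim_const; typeclasses eauto.
      - apply rlim_vnorm; [typeclasses eauto|exact Cx]. }
    rewrite E, vnorm_zero in H0; lra. }
  split; [exact Hlx|].
  apply (rlim_le (fun n => V (x (phi n)) (v (phi n))) (fun _ => c)).
  - intro n; apply (H (phi n)).
  - apply rlim_Vfun; auto; typeclasses eauto.
  - apply rlim_const; typeclasses eauto.
Qed.

(** The box hypothesis excludes [L = 0], so [critical_point] leaves only zeros of [V]. *)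
Lemma gradsq_eq_0 x v : in_sublevel mu k1 k2 L0 A0 c x v ->
  gradsq mu k1 k2 L0 A0 x v <= 0 -> V x v <= 0.
Proof.
  intros Hs Hg; destruct (sublevel_box _ _ Hs) as (_&_&_&HL).
  pose proof (dot_nonneg (gradx mu k1 k2 L0 A0 x v)) as P1.
  pose proof (dot_nonneg (gradv mu k1 k2 L0 A0 x v)) as P2.
  unfold gradsq in Hg.
  assert (E1 : gradx mu k1 k2 L0 A0 x v = vzero) by (apply dot_eq_0; lra).
  assert (E2 : gradv mu k1 k2 L0 A0 x v = vzero) by (apply dot_eq_0; lra).
  destruct (critical_point mu k1 k2 (invnorm x) L0 A0 x v Hk1 Hk2
    (invnorm_sq x (proj1 Hs)) HL L0_perp_A0 E1 E2) as [F1 F2].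
  unfold V; rewrite Vfun_dot; unfold Lmom; rewrite F1.
  change (Alrl mu x v) with (lrl mu (invnorm x) x v); rewrite F2.
  unfold dot, vzero; simpl; lra.
Qed.

(** Otherwise points with gradients tending to 0 would accumulate at a critical point in the
    sublevel set with [V >= eta]. *)
Lemma gradsq_lower_bound eta : 0 < eta ->
  exists m, 0 < m /\ forall x v, in_sublevel mu k1 k2 L0 A0 c x v -> eta <= V x v ->
    m <= gradsq mu k1 k2 L0 A0 x v.
Proof.
  intro Heta; apply NNPP; intro N.
  assert (K : forall n, exists p : vec3 * vec3,
    in_sublevel mu k1 k2 L0 A0 c (fst p) (snd p) /\ eta <= V (fst p) (snd p) /\
    gradsq mu k1 k2 L0 A0 (fst p) (snd p) <= / (INR n + 1)).
  { intro n; apply NNPP; intro N'; apply N; exists (/ (INR n + 1)); split.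
    - apply Rinv_0_lt_compat; pose proof (pos_INR n); lra.
    - intros x v H1 H2; apply Rnot_lt_le; intro H3; apply N'; exists (x, v); simpl.
      repeat split; try apply H1; auto; lra. }
  apply fun_choice in K; destruct K as [p Hp].
  destruct (sublevel_compact (fun n => fst (p n)) (fun n => snd (p n)))
    as (phi&lx&lv&Hphi&Cx&Cv&Hs).
  { intro n; apply Hp. }
  assert (H1 : eta <= V lx lv).
  { apply (rlim_le (fun _ => eta) (fun n => V (fst (p (phi n))) (snd (p (phi n))))).
    - intro n; apply Hp.
    - apply rlim_const; typeclasses eauto.
    - apply rlim_Vfun; auto; [typeclasses eauto|apply Hs]. }
  assert (H2 : gradsq mu k1 k2 L0 A0 lx lv <= 0).
  { apply (rlim_le (fun n => gradsq mu k1 k2 L0 A0 (fst (p (phi n))) (snd (p (phi n))))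
             (fun n => / (INR n + 1))).
    - intro n; apply Rle_trans with (1 := proj2 (proj2 (Hp (phi n)))).
      pose proof (pos_INR n); pose proof (le_INR _ _ (Hphi n)).
      apply Rinv_le_contravar; lra.
    - apply rlim_gradsq; auto; [typeclasses eauto|apply Hs].
    - exact is_lim_seq_inv_succ. }
  pose proof (gradsq_eq_0 lx lv Hs H2); lra.
Qed.

(** Counterexamples with [V] tending to 0 would accumulate at a point of the zero set, and that very
    point contradicts their distance from it. *)
Lemma near_zero_set eps : 0 < eps ->
  exists eta, 0 < eta /\ forall x v, in_sublevel mu k1 k2 L0 A0 c x v -> V x v <= eta ->
    exists xs vs, in_zero_set mu L0 A0 xs vs /\ dist6 x v xs vs < eps.
Proof.
  intro Heps; apply NNPP; intro N.
  assert (K : forall n, exists p : vec3 * vec3,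
    in_sublevel mu k1 k2 L0 A0 c (fst p) (snd p) /\ V (fst p) (snd p) <= / (INR n + 1) /\
    forall xs vs, in_zero_set mu L0 A0 xs vs -> eps <= dist6 (fst p) (snd p) xs vs).
  { intro n; apply NNPP; intro N'; apply N; exists (/ (INR n + 1)); split.
    - apply Rinv_0_lt_compat; pose proof (pos_INR n); lra.
    - intros x v H1 H2; apply NNPP; intro H3; apply N'; exists (x, v); simpl.
      repeat split; try apply H1; auto.
      intros xs vs Hz; apply Rnot_lt_le; intro H4; apply H3; eauto. }
  apply fun_choice in K; destruct K as [p Hp].
  destruct (sublevel_compact (fun n => fst (p n)) (fun n => snd (p n)))
    as (phi&lx&lv&Hphi&Cx&Cv&Hs).
  { intro n; apply Hp. }
  assert (H1 : V lx lv <= 0).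
  { apply (rlim_le (fun n => V (fst (p (phi n))) (snd (p (phi n)))) (fun n => / (INR n + 1))).
    - intro n; apply Rle_trans with (1 := proj1 (proj2 (Hp (phi n)))).
      pose proof (pos_INR n); pose proof (le_INR _ _ (Hphi n)).
      apply Rinv_le_contravar; lra.
    - apply rlim_Vfun; auto; [typeclasses eauto|apply Hs].
    - exact is_lim_seq_inv_succ. }
  assert (Hz : in_zero_set mu L0 A0 lx lv).
  { apply (Vfun_eq_0 mu k1 k2 L0 A0); auto; apply Hs. }
  assert (H2 : eps <= dist6 lx lv lx lv).
  { apply (rlim_le (fun _ => eps) (fun n => dist6 (fst (p (phi n))) (snd (p (phi n))) lx lv)).
    - intro n; now apply Hp.
    - apply rlim_const; typeclasses eauto.
    - unfold dist6; apply (rlim_comp _ _ sqrt); [|apply continuous_sqrt].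
      lim_tac; typeclasses eauto. }
  unfold dist6 in H2; rewrite !vsub_diag in H2.
  replace (dot vzero vzero + dot vzero vzero) with 0 in H2 by (unfold dot, vzero; simpl; ring).
  rewrite sqrt_0 in H2; lra.
Qed.

Lemma converges_to_zero_set (x v : R -> vec3) :
  is_fwd_sol (ctrl_xdot mu k1 k2 L0 A0) (ctrl_vdot mu k1 k2 L0 A0) None x v ->
  in_sublevel mu k1 k2 L0 A0 c (x 0) (v 0) ->
  forall eps, eps > 0 -> exists T0, forall t, t >= T0 ->
    exists xs vs, in_zero_set mu L0 A0 xs vs /\ dist6 (x t) (v t) xs vs < eps.
Proof.
  intros S H0 eps Heps.
  pose proof (Vfun_antitone mu k1 k2 L0 A0 None x v S) as Hmono; fold V in Hmono.
  assert (Hsub : forall t, 0 <= t -> in_sublevel mu k1 k2 L0 A0 c (x t) (v t)).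
  { intros t Ht; split; [apply S; simpl; auto|].
    apply Rle_trans with (2 := proj2 H0), Hmono; simpl; auto; lra. }
  destruct (near_zero_set eps Heps) as (eta&Heta&Hnear).
  destruct (gradsq_lower_bound eta Heta) as (m&Hm&Hgrad).
  assert (Hc : 0 <= c) by (apply Rle_trans with (2 := proj2 H0), Vfun_nonneg; auto).
  assert (Hcm : 0 <= c / m) by (apply Rdiv_le_0_compat; lra).
  (* The descent is counted from time 1, inside the range where the equation holds. A duration
     [c / m] uses up the value [c], and one more unit makes [V] negative. *)
  set (T0 := c / m + 2).
  assert (HT : V (x T0) (v T0) <= eta).
  (* If [V] exceeds [eta] at [T0], then by monotonicity it does so on all of [[1, T0]], where it
     falls at rate at least [m]. *)
  { apply Rnot_lt_le; intro Hlt.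
    assert (D : V (x T0) (v T0) + m * T0 <= V (x 1) (v 1) + m * 1).
    { apply (nonincreasing_of_derive_nonpos (fun t => V (x t) (v t) + m * t)
        (fun t => - gradsq mu k1 k2 L0 A0 (x t) (v t) + m)); [unfold T0; lra| |].
      - intros t Ht; apply (is_derive_plus (V := R_NormedModule)).
        + destruct S as (Sd&_&_&Sx); destruct (Sd t) as [S1 S2]; [lra|exact I|].
          apply is_derive_Vfun_ctrl; auto; apply Sx; [lra|exact I].
        + auto_derive; [exact I|ring].
      - intros t Ht.
        assert (m <= gradsq mu k1 k2 L0 A0 (x t) (v t)); [|lra].
        apply Hgrad; [apply Hsub; lra|].
        apply Rle_trans with (1 := Rlt_le _ _ Hlt), Hmono; [lra|exact I]. }
    assert (Hm1 : m * T0 = c + 2 * m) by (unfold T0; field; lra).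
    pose proof (proj2 (Hsub 1 Rle_0_1)) as Hc1; fold V in Hc1; lra. }
  exists T0; intros t Ht.
  assert (HT0 : 0 <= T0) by (unfold T0; lra).
  apply Hnear; [apply Hsub; lra|].
  apply Rle_trans with (2 := HT), Hmono; [lra|exact I].
Qed.
End Convergence.

Theorem theorem6 (mu k1 k2 : R) (x0 v0 : vec3)
  (Hmu : mu > 0) (Hk1 : k1 > 0) (Hk2 : k2 > 0)
  (Hx0 : x0 <> vzero)
  (HL0 : Lmom x0 v0 <> vzero)
  (HA0 : vnorm (Alrl mu x0 v0) < mu)
  (c : R) (Hc0 : 0 < c)
  (Hc1 : c < k1 * (vnorm (Lmom x0 v0)) ^ 2 / 2)
  (Hc2 : c < k2 * (mu - vnorm (Alrl mu x0 v0)) ^ 2 / 2) :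
  let L0 := Lmom x0 v0 in
  let A0 := Alrl mu x0 v0 in
  let Fx := ctrl_xdot mu k1 k2 L0 A0 in
  let Fv := ctrl_vdot mu k1 k2 L0 A0 in
  (* trajectories starting in V^{-1}([0,c]) exist for all t >= 0 *)
  (forall xi vi, in_sublevel mu k1 k2 L0 A0 c xi vi ->
     exists x v : R -> vec3, x 0 = xi /\ v 0 = vi /\ is_fwd_sol Fx Fv None x v)
  /\
  (* every trajectory starting in V^{-1}([0,c]) stays there *)
  (forall (T : option R) (x v : R -> vec3), is_fwd_sol Fx Fv T x v ->
     in_sublevel mu k1 k2 L0 A0 c (x 0) (v 0) ->
     forall t, 0 <= t -> before T t -> in_sublevel mu k1 k2 L0 A0 c (x t) (v t))
  /\
  (* and converges to V^{-1}(0) as t -> infinity *)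
  (forall x v : R -> vec3, is_fwd_sol Fx Fv None x v ->
     in_sublevel mu k1 k2 L0 A0 c (x 0) (v 0) ->
     forall eps, eps > 0 -> exists T0, forall t, t >= T0 ->
       exists xs vs, in_zero_set mu L0 A0 xs vs /\ dist6 (x t) (v t) xs vs < eps)
  /\
  (* V^{-1}(0) is invariant under the controlled system *)
  (forall (a b t0 : R) (x v : R -> vec3), is_sol_on Fx Fv a b x v ->
     a < t0 < b -> in_zero_set mu L0 A0 (x t0) (v t0) ->
     forall t, a < t < b -> in_zero_set mu L0 A0 (x t) (v t))
  /\
  (* and under the Kepler system *)
  (forall (a b t0 : R) (x v : R -> vec3), is_sol_on (kep_xdot mu) (kep_vdot mu) a b x v ->
     a < t0 < b -> in_zero_set mu L0 A0 (x t0) (v t0) ->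
     forall t, a < t < b -> in_zero_set mu L0 A0 (x t) (v t)).
Proof.
  intros L0 A0 Fx Fv.
  destruct (sublevel_bounds mu k1 k2 c L0 A0) as (r&M&Hr&HM&Hbox); auto.
  (* [A0] combines [cross v0 L0] and [x0], both orthogonal to [L0], whatever the coefficient of
     [x0]; hence the generalization. *)
  assert (Hperp : dot L0 A0 = 0).
  { unfold L0, A0, Alrl; generalize (mu / vnorm x0); clear; vec_ring. }
  split; [|split; [|split; [|split]]].
  - exact (global_existence mu k1 k2 c r M L0 A0 Hr HM Hbox).
  - intros T x v S [Hx HV] t Ht HT; split; [now apply S|].
    apply Rle_trans with (2 := HV).
    apply (Vfun_antitone mu k1 k2 L0 A0 T x v S); [lra|exact HT].
  - now apply (converges_to_zero_set mu k1 k2 c r M).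
  - intros a b t0 x v; now apply zero_set_invariant_ctrl.
  - intros a b t0 x v; apply zero_set_invariant_kep.
Qed.
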